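(* Let $\mathcal C$ be a rigid monoidal category. The following are equivalent: (i) The category $\mathcal C$ is quasi-pivotal, i.e. it admits a quasi-pivotal structure. (ii) There exists a $\mathcal C$-invertible object in the anti-Drinfeld centre $\mathsf A(\mathcal C)$. (iii) The Drinfeld centre $\mathsf Z(\mathcal C)$ and the anti-Drinfeld centre $\mathsf A(\mathcal C)$ are equivalent as left module categories over $\mathsf Z(\mathcal C)$.
   Context: Monoidal categories are taken to be strict. A monoidal category $\mathcal C$ is rigid if every object $X$ has a left dual $X^\vee$ (with $\mathrm{ev}^l_X\colon X^\vee\otimes X\to 1$ and $\mathrm{coev}^l_X\colon 1\to X\otimes X^\vee$ satisfying the snake identities) and a right dual; a choice of duals is fixed. The double left dual functor $(-)^{\vee\vee}\colon\mathcal C\to\mathcal C$ is monoidal via the canonical isomorphisms $(X\otimes Y)^{\vee\vee}\cong X^{\vee\vee}\otimes Y^{\vee\vee}$, $1^{\vee\vee}\cong 1$, which are suppressed below. (The paper allows itself to assume that $\mathcal C$ is strict rigid, i.e. that left and right dualising are strict monoidal and mutually inverse, so that these canonical isomorphisms are identities.) An object is invertible if its left evaluation and coevaluation are isomorphisms. A quasi-pivotal structure on $\mathcal C$ is a pair $(\beta,\rho_\beta)$ of an invertible object $\beta\in\mathcal C$ and a monoidal natural isomorphism $\rho_\beta\colon \mathrm{Id}_{\mathcal C}\to\beta\otimes(-)^{\vee\vee}\otimes\beta^\vee$ (the target functor is monoidal using $\mathrm{ev}^l_\beta\colon\beta^\vee\otimes\beta\to 1$ and $\mathrm{coev}^l_\beta$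 and their inverses). Drinfeld centre $\mathsf Z(\mathcal C)$: objects are pairs $(X,\sigma_{X,-})$ with $X\in\mathcal C$ and $\sigma_{X,Y}\colon X\otimes Y\to Y\otimes X$ an isomorphism natural in $Y$ with $\sigma_{X,Y\otimes W}=(\mathrm{id}_Y\otimes\sigma_{X,W})(\sigma_{X,Y}\otimes\mathrm{id}_W)$; morphisms are morphisms of $\mathcal C$ commuting with the half-braidings. It is monoidal with $\sigma_{X\otimes X',Y}=(\sigma_{X,Y}\otimes\mathrm{id}_{X'})(\mathrm{id}_X\otimes\sigma_{X',Y})$. Anti-Drinfeld centre $\mathsf A(\mathcal C)$: objects are pairs $(A,\sigma_{A,-})$ with $A\in\mathcal C$ and $\sigma_{A,Y}\colon A\otimes Y^{\vee\vee}\to Y\otimes A$ an isomorphism natural in $Y\in\mathcal C$ with $\sigma_{A,Y\otimes W}=(\mathrm{id}_Y\otimes\sigma_{A,W})(\sigma_{A,Y}\otimes\mathrm{id}_{W^{\vee\vee}})$; morphisms are morphisms of $\mathcal C$ commuting with the half-braidings. $\mathsf Z(\mathcal C)$ acts on $\mathsf A(\mathcal C)$ from the left by $X\otimes A$ with half-braiding $\sigma_{X\otimes A,Y}=(\sigma_{X,Y}\otimes\mathrm{id}_A)(\mathrm{id}_X\otimes\sigma_{A,Y})$. An object of $\mathsf A(\mathcal C)$ is $\mathcal C$-invertible if its underlying object in $\mathcal C$ is invertible. A functor of left module categories over $\mathsf Z(\mathcal C)$ is a functor $F$ with a natural isomorphism $\delta_{X,M}\colon F(X\otimes M)\to X\otimes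 F(M)$ satisfying $\delta_{X\otimes Y,M}=(\mathrm{id}_X\otimes\delta_{Y,M})\delta_{X,Y\otimes M}$ and $\delta_{1,M}=\mathrm{id}$. Two module categories are equivalent if there is such a functor that is an equivalence of categories. $\mathsf Z(\mathcal C)$ is a left module category over itself via its tensor product. *)

(* Defs.v *)
From Stdlib Require Import Setoid FunctionalExtensionality ProofIrrelevance.

Set Implicit Arguments.
Unset Strict Implicit.
Unset Printing Implicit Defensive.

(** Strictness of a monoidal category is an equality between objects.  With a
    dependent family [Hom X Y : Type] every strict identity between morphisms
    would need transports along such equalities.  We therefore use a single type
    of arrows and let each hom-set be a subset of it: [hom X Y f] says that [f] is
    a morphism from [X] to [Y].  Hom-sets need not be disjoint; this lets the
    centres below have the arrows of the underlying category as arrows.  The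
    composition [g ∘ f] ([f] first) is total on arrows, but its value is
    constrained only when [f] and [g] are composable morphisms. *)
Record category := Category {
  Ob : Type;
  Arr : Type;
  hom : Ob -> Ob -> Arr -> Prop;
  idm : Ob -> Arr;
  comp : Arr -> Arr -> Arr;
  idm_hom : forall X, hom X X (idm X);
  comp_hom : forall X Y Z g f, hom Y Z g -> hom X Y f -> hom X Z (comp g f);
  comp_idl : forall X Y f, hom X Y f -> comp (idm Y) f = f;
  comp_idr : forall X Y f, hom X Y f -> comp f (idm X) = f;
  compA : forall W X Y Z h g f, hom Y Z h -> hom X Y g -> hom W X f ->
    comp h (comp g f) = comp (comp h g) f
}.

Arguments hom {c} X Y f.
Arguments idm {c} X.
Arguments comp {c} g f.

Declare Scope cat_scope.
Delimit Scope cat_scope with cat.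
Open Scope cat_scope.

Notation "g ∘ f" := (comp g f) (at level 40, left associativity) : cat_scope.
Notation "[ f : X ~> Y ]" := (hom X Y f)
  (at level 0, f at level 99, X at level 99, Y at level 99,
   format "[ f  :  X  ~>  Y ]") : cat_scope.

Definition is_iso (C : category) (X Y : Ob C) (f : Arr C) : Prop :=
  [f : X ~> Y] /\
  exists g, [g : Y ~> X] /\ g ∘ f = idm X /\ f ∘ g = idm Y.

(** The action on arrows also receives the source and the target, since an arrow
    may belong to several hom-sets. *)
Record functor (C D : category) := Functor {
  fob :> Ob C -> Ob D;
  fmap : Ob C -> Ob C -> Arr C -> Arr D;
  fmap_hom : forall X Y f, [f : X ~> Y] -> [fmap X Y f : fob X ~> fob Y];
  fmap_id : forall X, fmap X X (idm X) = idm (fob X);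
  fmap_comp : forall X Y Z g f, [g : Y ~> Z] -> [f : X ~> Y] ->
    fmap X Z (g ∘ f) = fmap Y Z g ∘ fmap X Y f
}.

Definition id_functor (C : category) : functor C C.
Proof. now refine (@Functor C C (fun X => X) (fun _ _ f => f) _ _ _). Defined.

Definition comp_functor (C D E : category)
    (G : functor D E) (F : functor C D) : functor C E.
Proof.
refine (@Functor C E (fun X => G (F X))
          (fun X Y f => fmap G (F X) (F Y) (fmap F X Y f)) _ _ _).
- intros X Y f Hf. now apply fmap_hom, fmap_hom.
- intros X. now rewrite !fmap_id.
- intros X Y Z g f Hg Hf.
  now rewrite (fmap_comp F Hg Hf), (fmap_comp G (fmap_hom F Hg) (fmap_hom F Hf)).
Defined.

Definition is_nat_iso (C D : category) (F G : functor C D) (eta : Ob C -> Arr D)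
    : Prop :=
  (forall X, is_iso (F X) (G X) (eta X)) /\
  (forall X Y f, [f : X ~> Y] -> fmap G X Y f ∘ eta X = eta Y ∘ fmap F X Y f).

Definition is_equivalence (C D : category) (F : functor C D) : Prop :=
  exists G : functor D C,
    (exists eta, is_nat_iso (id_functor C) (comp_functor G F) eta) /\
    (exists eps, is_nat_iso (comp_functor F G) (id_functor D) eps).

Record monoidal := Monoidal {
  mcat :> category;
  munit : Ob mcat;
  tens : Ob mcat -> Ob mcat -> Ob mcat;
  tensm : Arr mcat -> Arr mcat -> Arr mcat;
  tensm_hom : forall X X' Y Y' f g, [f : X ~> X'] -> [g : Y ~> Y'] ->
    [tensm f g : tens X Y ~> tens X' Y'];
  tensm_id : forall X Y, tensm (idm X) (idm Y) = idm (tens X Y);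
  tensm_comp : forall X X' X'' Y Y' Y'' f' f g' g,
    [f' : X' ~> X''] -> [f : X ~> X'] -> [g' : Y' ~> Y''] -> [g : Y ~> Y'] ->
    tensm (f' ∘ f) (g' ∘ g) = tensm f' g' ∘ tensm f g;
  tensA : forall X Y Z, tens X (tens Y Z) = tens (tens X Y) Z;
  tens1l : forall X, tens munit X = X;
  tens1r : forall X, tens X munit = X;
  tensmA : forall X X' Y Y' Z Z' f g h,
    [f : X ~> X'] -> [g : Y ~> Y'] -> [h : Z ~> Z'] ->
    tensm f (tensm g h) = tensm (tensm f g) h;
  tensm1l : forall X X' f, [f : X ~> X'] -> tensm (idm munit) f = f;
  tensm1r : forall X X' f, [f : X ~> X'] -> tensm f (idm munit) = f
}.

Arguments munit {m}.
Arguments tens {m} X Y.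
Arguments tensm {m} f g.

Notation "'𝟙'" := munit : cat_scope.
Notation "X ⊗ Y" := (tens X Y) (at level 38, left associativity) : cat_scope.
Notation "f ⊗' g" := (tensm f g) (at level 38, left associativity) : cat_scope.

Lemma hom_cast (C : category) (X Y X' Y' : Ob C) f :
  [f : X ~> Y] -> X = X' -> Y = Y' -> [f : X' ~> Y'].
Proof. now intros H <- <-. Qed.

Lemma comp_hom_cast (C : category) (X Y Y' Z : Ob C) g f :
  [g : Y' ~> Z] -> [f : X ~> Y] -> Y = Y' -> [g ∘ f : X ~> Z].
Proof. intros Hg Hf <-. exact (comp_hom Hg Hf). Qed.

Create HintDb cat.

Ltac objeq :=
  simpl; first [ reflexivity
  | rewrite ?tens1l, ?tens1r, ?tensA, ?tens1l, ?tens1r; reflexivity ].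

(* Types an arrow bottom-up, allowing for strictness of the tensor product. *)
Ltac typ :=
  match goal with
  | |- hom _ _ (idm _) => apply idm_hom
  | |- hom _ _ (tensm _ _) => eapply tensm_hom; [typ | typ]
  | |- hom _ _ (comp _ _) => eapply comp_hom_cast; [typ | typ | objeq]
  | |- hom _ _ (fmap _ _ _ _) =>
      apply fmap_hom; eapply hom_cast; [typ | objeq | objeq]
  | |- hom _ _ (fmap _ _ _ _) =>
      apply fmap_hom; eapply hom_cast; [typ | objeq | objeq]
  | |- hom _ _ (fmap _ _ _ _) =>
      apply fmap_hom; eapply hom_cast; [typ | objeq | objeq]
  | |- hom _ _ (fmap _ _ _ _) =>
      apply fmap_hom; eapply hom_cast; [typ | objeq | objeq]
  | |- hom _ _ (fmap _ _ _ _) =>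
      apply fmap_hom; eapply hom_cast; [typ | objeq | objeq]
  | |- hom _ _ (fmap _ _ _ _) =>
      apply fmap_hom; eapply hom_cast; [typ | objeq | objeq]
  | |- hom _ _ (fmap _ _ _ _) =>
      apply fmap_hom; eapply hom_cast; [typ | objeq | objeq]
  | |- hom _ _ (fmap _ _ _ _) =>
      apply fmap_hom; eapply hom_cast; [typ | objeq | objeq]
  | |- hom _ _ _ => first [ eassumption | solve [eauto with cat nocore] ]
  end.

Ltac homt :=
  lazymatch goal with
  | |- hom _ _ _ => first [ eassumption | eapply hom_cast; [typ | objeq | objeq] ]
  end.

Lemma is_iso_id (C : category) (X : Ob C) : is_iso X X (idm X).
Proof.
split; [apply idm_hom|]. exists (idm X). split; [apply idm_hom|].
now rewrite (comp_idl (idm_hom X)).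
Qed.

Section Tensor.
Variable C : monoidal.
Implicit Types W V X Y Z : Ob C.

Lemma tens_exch X X' Y Y' f g : [f : X ~> X'] -> [g : Y ~> Y'] ->
  (f ⊗' idm Y') ∘ (idm X ⊗' g) = f ⊗' g.
Proof.
intros Hf Hg.
erewrite <- tensm_comp by homt.
now erewrite comp_idr, comp_idl by homt.
Qed.

Lemma tens_exch' X X' Y Y' f g : [f : X ~> X'] -> [g : Y ~> Y'] ->
  (idm X' ⊗' g) ∘ (f ⊗' idm Y) = f ⊗' g.
Proof.
intros Hf Hg.
erewrite <- tensm_comp by homt.
now erewrite comp_idr, comp_idl by homt.
Qed.

Lemma tens_compl W X Y Z g f : [g : Y ~> Z] -> [f : X ~> Y] ->
  idm W ⊗' (g ∘ f) = (idm W ⊗' g) ∘ (idm W ⊗' f).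
Proof.
intros Hg Hf.
erewrite <- tensm_comp by homt.
now erewrite comp_idl by homt.
Qed.

Lemma tens_compr W X Y Z g f : [g : Y ~> Z] -> [f : X ~> Y] ->
  (g ∘ f) ⊗' idm W = (g ⊗' idm W) ∘ (f ⊗' idm W).
Proof.
intros Hg Hf.
erewrite <- tensm_comp by homt.
now erewrite comp_idl by homt.
Qed.

End Tensor.

(* Expands an arrow into a composite, associated to the left, of tensor products,
   associated to the left, of arrows that are neither. *)
Ltac flat := repeat first
  [ rewrite tens1l | rewrite tens1r
  | erewrite tens_compl by homt | erewrite tens_compr by homt
  | erewrite tensm1l by homt | erewrite tensm1r by homt
  | erewrite tensmA by homt | erewrite compA by homt
  | rewrite <- tensm_id ].

Lemma exch (C : monoidal) (W V X X' Y Y' : Ob C) f g :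
  [f : X ~> X'] -> [g : Y ~> Y'] -> 
  (idm W ⊗' (idm X' ⊗' g) ⊗' idm V) ∘ (idm W ⊗' (f ⊗' idm Y) ⊗' idm V)
  = (idm W ⊗' (f ⊗' idm Y') ⊗' idm V) ∘ (idm W ⊗' (idm X ⊗' g) ⊗' idm V).
Proof.
intros Hf Hg.
erewrite <- !tens_compr by homt. erewrite <- !tens_compl by homt.
now erewrite tens_exch', tens_exch by homt.
Qed.

Lemma is_iso_comp (C : category) (X Y Z : Ob C) f g :
  is_iso Y Z g -> is_iso X Y f -> is_iso X Z (g ∘ f).
Proof.
intros (Hg & g' & Hg' & Eg & Eg') (Hf & f' & Hf' & Ef & Ef').
split; [exact (comp_hom Hg Hf)|].
exists (f' ∘ g'). split; [exact (comp_hom Hf' Hg')|]. split.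
- rewrite (compA (comp_hom Hf' Hg') Hg Hf), <- (compA Hf' Hg' Hg), Eg.
  now rewrite (comp_idr Hf').
- rewrite (compA (comp_hom Hg Hf) Hf' Hg'), <- (compA Hg Hf Hf'), Ef'.
  now rewrite (comp_idr Hg).
Qed.

Lemma is_iso_tens (C : monoidal) (X X' Y Y' : Ob C) f g :
  is_iso X X' f -> is_iso Y Y' g -> is_iso (X ⊗ Y) (X' ⊗ Y') (f ⊗' g).
Proof.
intros (Hf & f' & Hf' & Ef & Ef') (Hg & g' & Hg' & Eg & Eg').
split; [homt|]. exists (f' ⊗' g'). split; [homt|].
split; erewrite <- tensm_comp by homt.
- now rewrite Ef, Eg, tensm_id.
- now rewrite Ef', Eg', tensm_id.
Qed.

Lemma is_iso_cast (C : category) (X Y X' Y' : Ob C) f :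
  is_iso X Y f -> X = X' -> Y = Y' -> is_iso X' Y' f.
Proof. now intros H <- <-. Qed.

Lemma is_iso_fmap (C D : category) (F : functor C D) (X Y : Ob C) f :
  is_iso X Y f -> is_iso (F X) (F Y) (fmap F X Y f).
Proof.
intros (Hf & g & Hg & E & E'). split; [now apply fmap_hom|].
exists (fmap F Y X g). split; [now apply fmap_hom|].
now rewrite <- (fmap_comp F Hg Hf), <- (fmap_comp F Hf Hg), E, E', !fmap_id.
Qed.

Record monoidal_functor (C D : monoidal) := MonoidalFunctor {
  mf :> functor C D;
  mf_mult : Ob C -> Ob C -> Arr D;
  mf_unit : Arr D;
  mf_mult_iso : forall X Y, is_iso (mf X ⊗ mf Y) (mf (X ⊗ Y)) (mf_mult X Y);
  mf_unit_iso : is_iso 𝟙 (mf 𝟙) mf_unit;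
  mf_mult_nat : forall X X' Y Y' f g, [f : X ~> X'] -> [g : Y ~> Y'] ->
    mf_mult X' Y' ∘ (fmap mf X X' f ⊗' fmap mf Y Y' g)
    = fmap mf (X ⊗ Y) (X' ⊗ Y') (f ⊗' g) ∘ mf_mult X Y;
  mf_multA : forall X Y Z,
    mf_mult (X ⊗ Y) Z ∘ (mf_mult X Y ⊗' idm (mf Z))
    = mf_mult X (Y ⊗ Z) ∘ (idm (mf X) ⊗' mf_mult Y Z);
  mf_mult1l : forall X, mf_mult 𝟙 X ∘ (mf_unit ⊗' idm (mf X)) = idm (mf X);
  mf_mult1r : forall X, mf_mult X 𝟙 ∘ (idm (mf X) ⊗' mf_unit) = idm (mf X)
}.

Definition is_monoidal_nat_iso (C D : monoidal) (F G : monoidal_functor C D)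
    (eta : Ob C -> Arr D) : Prop :=
  is_nat_iso F G eta /\
  (forall X Y, eta (X ⊗ Y) ∘ mf_mult F X Y = mf_mult G X Y ∘ (eta X ⊗' eta Y)) /\
  eta 𝟙 ∘ mf_unit F = mf_unit G.

Definition id_monoidal (C : monoidal) : monoidal_functor C C.
Proof.
refine (@MonoidalFunctor C C (id_functor C) (fun X Y => idm (X ⊗ Y)) (idm 𝟙)
          _ _ _ _ _ _); simpl.
- intros X Y. apply is_iso_id.
- apply is_iso_id.
- intros X X' Y Y' f g Hf Hg. now erewrite comp_idl, comp_idr by homt.
- intros X Y Z. now rewrite !tensm_id, tensA.
- intros X. now rewrite tensm_id, comp_idl with (X := 𝟙 ⊗ X), tens1l by homt.
- intros X. now rewrite tensm_id, comp_idl with (X := X ⊗ 𝟙), tens1r by homt.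
Defined.

Lemma compA4 (C : category) (V W X Y Z : Ob C) k h g f :
  [k : Y ~> Z] -> [h : X ~> Y] -> [g : W ~> X] -> [f : V ~> W] ->
  (k ∘ h) ∘ (g ∘ f) = k ∘ (h ∘ g) ∘ f.
Proof.
intros Hk Hh Hg Hf.
rewrite (compA (comp_hom Hk Hh) Hg Hf). f_equal.
symmetry. apply (compA Hk Hh Hg).
Qed.

Lemma mf_mult_hom (C D : monoidal) (F : monoidal_functor C D) X Y :
  [mf_mult F X Y : F X ⊗ F Y ~> F (X ⊗ Y)].
Proof. apply mf_mult_iso. Qed.

Lemma mf_unit_hom (C D : monoidal) (F : monoidal_functor C D) :
  [mf_unit F : 𝟙 ~> F 𝟙].
Proof. apply mf_unit_iso. Qed.

#[export] Hint Resolve fmap_hom mf_mult_hom mf_unit_hom : cat.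

Definition comp_monoidal (C D E : monoidal)
    (G : monoidal_functor D E) (F : monoidal_functor C D) : monoidal_functor C E.
Proof.
refine (@MonoidalFunctor C E (comp_functor G F)
  (fun X Y => fmap G (F X ⊗ F Y) (F (X ⊗ Y)) (mf_mult F X Y)
              ∘ mf_mult G (F X) (F Y))
  (fmap G 𝟙 (F 𝟙) (mf_unit F) ∘ mf_unit G) _ _ _ _ _ _); simpl.
- intros X Y. exact (is_iso_comp (is_iso_fmap _ (mf_mult_iso _ _ _)) (mf_mult_iso _ _ _)).
- exact (is_iso_comp (is_iso_fmap _ (mf_unit_iso _)) (mf_unit_iso _)).
- intros X X' Y Y' f g Hf Hg.
  pose proof (fmap_hom F Hf) as Ff. pose proof (fmap_hom F Hg) as Fg.
  assert (Hfg : [f ⊗' g : X ⊗ Y ~> X' ⊗ Y']) by homt.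
  erewrite <- compA by homt.
  rewrite (mf_mult_nat G Ff Fg).
  erewrite !compA by homt. f_equal.
  rewrite <- (fmap_comp G (fmap_hom F Hfg) (mf_mult_hom F X Y)),
    <- (mf_mult_nat F Hf Hg).
  symmetry. apply fmap_comp; homt.
- intros X Y Z.
  erewrite tens_compr by homt. erewrite tens_compl by homt.
  erewrite !compA4 by homt.
  rewrite <- !(fmap_id G).
  erewrite !mf_mult_nat by homt.
  erewrite <- !compA4 by homt.
  erewrite <- !fmap_comp by homt.
  rewrite !(fmap_id G), !mf_multA, !tensA. reflexivity.
- intros X.
  erewrite tens_compr by homt. erewrite compA4 by homt.
  rewrite <- (fmap_id G). erewrite mf_mult_nat by homt.
  erewrite <- compA4 by homt. erewrite <- fmap_comp by homt.
  rewrite (fmap_id G), !mf_mult1l, !tens1l, fmap_id.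
  apply (comp_idl (idm_hom _)).
- intros X.
  erewrite tens_compl by homt. erewrite compA4 by homt.
  rewrite <- (fmap_id G). erewrite mf_mult_nat by homt.
  erewrite <- compA4 by homt. erewrite <- fmap_comp by homt.
  rewrite (fmap_id G), !mf_mult1r, !tens1r, fmap_id.
  apply (comp_idl (idm_hom _)).
Defined.

Record rigid := Rigid {
  rmon :> monoidal;
  ldual : Ob rmon -> Ob rmon;
  evl : Ob rmon -> Arr rmon;
  coevl : Ob rmon -> Arr rmon;
  evl_hom : forall X, [evl X : ldual X ⊗ X ~> 𝟙];
  coevl_hom : forall X, [coevl X : 𝟙 ~> X ⊗ ldual X];
  snakel1 : forall X, (idm X ⊗' evl X) ∘ (coevl X ⊗' idm X) = idm X;
  snakel2 : forall X,
    (evl X ⊗' idm (ldual X)) ∘ (idm (ldual X) ⊗' coevl X) = idm (ldual X);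
  rdual : Ob rmon -> Ob rmon;
  evr : Ob rmon -> Arr rmon;
  coevr : Ob rmon -> Arr rmon;
  evr_hom : forall X, [evr X : X ⊗ rdual X ~> 𝟙];
  coevr_hom : forall X, [coevr X : 𝟙 ~> rdual X ⊗ X];
  snaker1 : forall X, (evr X ⊗' idm X) ∘ (idm X ⊗' coevr X) = idm X;
  snaker2 : forall X,
    (idm (rdual X) ⊗' evr X) ∘ (coevr X ⊗' idm (rdual X)) = idm (rdual X)
}.

Arguments ldual {r} X.
Arguments evl {r} X.
Arguments coevl {r} X.
Arguments rdual {r} X.
Arguments evr {r} X.
Arguments coevr {r} X.

Notation "X ^∨" := (ldual X) (at level 2, left associativity, format "X ^∨")
  : cat_scope.
Notation "X ^∨∨" := (ldual (ldual X))
  (at level 2, left associativity, format "X ^∨∨") : cat_scope.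

#[export] Hint Resolve evl_hom coevl_hom evr_hom coevr_hom : cat.

Definition invertible (C : rigid) (X : Ob C) : Prop :=
  is_iso (X^∨ ⊗ X) 𝟙 (evl X) /\ is_iso 𝟙 (X ⊗ X^∨) (coevl X).

Section Duality.
Variable C : rigid.
Implicit Types X Y Z D E : Ob C.

(** [is_dual X D e c]: [D] is a left dual of [X] with evaluation [e] and
    coevaluation [c]. *)
Definition is_dual X D (e c : Arr C) : Prop :=
  [e : D ⊗ X ~> 𝟙] /\ [c : 𝟙 ~> X ⊗ D] /\
  (idm X ⊗' e) ∘ (c ⊗' idm X) = idm X /\
  (e ⊗' idm D) ∘ (idm D ⊗' c) = idm D.

(** The mate [E -> D] of [f : X -> Y], for left duals [D] of [X], with
    coevaluation [c], and [E] of [Y], with evaluation [e]. *)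
Definition mate E (e f : Arr C) D (c : Arr C) : Arr C :=
  (e ⊗' idm D) ∘ (idm E ⊗' f ⊗' idm D) ∘ (idm E ⊗' c).

(** The left dual [f^∨ : Y^∨ -> X^∨] of [f : X -> Y]. *)
Definition dualm X Y (f : Arr C) : Arr C := mate Y^∨ (evl Y) f X^∨ (coevl X).

(** If [D] is a left dual of [X] and [E] is one of [Y], then [E ⊗ D] is a left
    dual of [X ⊗ Y] with the following evaluation and coevaluation. *)
Definition ev_tens Y E (eX eY : Arr C) : Arr C := eY ∘ (idm E ⊗' eX ⊗' idm Y).
Definition coev_tens X D (cX cY : Arr C) : Arr C := (idm X ⊗' cY ⊗' idm D) ∘ cX.

(** The canonical isomorphism [(X ⊗ Y)^∨ -> Y^∨ ⊗ X^∨]. *)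
Definition dual_tens X Y : Arr C :=
  mate (X ⊗ Y)^∨ (evl (X ⊗ Y)) (idm (X ⊗ Y))
       (Y^∨ ⊗ X^∨) (coev_tens X X^∨ (coevl X) (coevl Y)).

(** The canonical isomorphism [X^∨∨ ⊗ Y^∨∨ -> (X ⊗ Y)^∨∨]: the mate of
    [dual_tens X Y], where [X^∨∨ ⊗ Y^∨∨] is regarded as a left dual of
    [Y^∨ ⊗ X^∨]. *)
Definition dd_mult X Y : Arr C :=
  mate (X^∨∨ ⊗ Y^∨∨) (ev_tens X^∨ X^∨∨ (evl Y^∨) (evl X^∨)) (dual_tens X Y)
       (X ⊗ Y)^∨∨ (coevl (X ⊗ Y)^∨).

(** The canonical isomorphism [𝟙 -> 𝟙^∨∨]: the mate of [evl 𝟙 : 𝟙^∨ -> 𝟙],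
    where [𝟙] is regarded as a left dual of itself. *)
Definition dd_unit : Arr C := mate 𝟙 (idm 𝟙) (evl 𝟙) 𝟙^∨∨ (coevl 𝟙^∨).

Definition ddm X Y (f : Arr C) : Arr C := dualm Y^∨ X^∨ (dualm X Y f).

Lemma is_dual_ldual X : is_dual X X^∨ (evl X) (coevl X).
Proof. repeat split; [apply evl_hom|apply coevl_hom|apply snakel1|apply snakel2]. Qed.

Section Mate.
Variables (X D Y E : Ob C) (e c e' c' f : Arr C).
Hypotheses (HX : is_dual X D e c) (HY : is_dual Y E e' c') (Hf : [f : X ~> Y]).

Lemma mate_hom : [mate E e' f D c : E ~> D].
Proof.
destruct HX as (He & Hc & _), HY as (He' & Hc' & _).
unfold mate. homt.
Qed.

Lemma mateE : mate E e' f D c = ((e' ∘ (idm E ⊗' f)) ⊗' idm D) ∘ (idm E ⊗' c).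
Proof.
destruct HX as (He & Hc & _), HY as (He' & Hc' & _).
unfold mate. now erewrite tens_compr by homt.
Qed.

Lemma mate_ev : e ∘ (mate E e' f D c ⊗' idm X) = e' ∘ (idm E ⊗' f).
Proof.
destruct HX as (He & Hc & Hs & _), HY as (He' & Hc' & _).
rewrite mateE.
assert (Hg : [e' ∘ (idm E ⊗' f) : E ⊗ X ~> 𝟙]) by homt.
set (g := e' ∘ (idm E ⊗' f)) in *.
erewrite tens_compr by homt.
erewrite compA by homt.
erewrite <- (tensmA (f:=g)) by homt.
rewrite tensm_id.
transitivity (g ∘ (idm E ⊗' ((idm X ⊗' e) ∘ (c ⊗' idm X)))).
- erewrite tens_compl by homt.
  erewrite (compA (h:=g)) by homt.
  erewrite <- (tensmA (g:=c)) by homt. f_equal.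
  erewrite (tensmA (h:=e)) by homt. rewrite tensm_id.
  transitivity (g ⊗' e).
  + erewrite <- (tens_exch' (f:=g) (g:=e)) by homt.
    now erewrite tensm1l by homt.
  + erewrite <- (tens_exch (f:=g) (g:=e)) by homt.
    now erewrite tensm1r by homt.
- rewrite Hs, tensm_id. now erewrite comp_idr by homt.
Qed.

Lemma ev_inj g g' : [g : E ~> D] -> [g' : E ~> D] ->
  e ∘ (g ⊗' idm X) = e ∘ (g' ⊗' idm X) -> g = g'.
Proof.
destruct HX as (He & Hc & Hs & Hs').
assert (H : forall h, [h : E ~> D] ->
  h = ((e ∘ (h ⊗' idm X)) ⊗' idm D) ∘ (idm E ⊗' c)).
{ intros h Hh.
  erewrite tens_compr by homt.
  erewrite <- compA by homt.
  erewrite <- (tensmA (f:=h)) by homt. rewrite tensm_id.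
  erewrite (tens_exch (f:=h) (g:=c)) by homt.
  erewrite <- (tens_exch' (f:=h) (g:=c)) by homt.
  erewrite compA by homt. rewrite Hs'.
  erewrite (tensm1r (f:=h)) by homt. now erewrite comp_idl by homt. }
intros Hg Hg' Heq. rewrite (H g Hg), (H g' Hg'). now rewrite Heq.
Qed.

Lemma mate_unique g : [g : E ~> D] ->
  e ∘ (g ⊗' idm X) = e' ∘ (idm E ⊗' f) -> g = mate E e' f D c.
Proof.
intros Hg H. apply ev_inj; [assumption|apply mate_hom|].
now rewrite mate_ev.
Qed.

End Mate.

Lemma mate_id X D e c : is_dual X D e c -> mate D e (idm X) D c = idm D.
Proof.
intros H. symmetry. apply (mate_unique H H); [homt|homt|reflexivity].
Qed.

Lemma mate_comp X D e c Y E e' c' Z F e'' c'' f g :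
  is_dual X D e c -> is_dual Y E e' c' -> is_dual Z F e'' c'' ->
  [f : X ~> Y] -> [g : Y ~> Z] ->
  mate E e' f D c ∘ mate F e'' g E c' = mate F e'' (g ∘ f) D c.
Proof.
intros HX HY HZ Hf Hg.
pose proof (mate_hom HX HY Hf) as Hm. pose proof (mate_hom HY HZ Hg) as Hn.
apply (mate_unique HX HZ); [homt|homt|].
pose proof (mate_ev HX HY Hf) as Em. pose proof (mate_ev HY HZ Hg) as En.
destruct HX as (He & Hc & _), HY as (He' & Hc' & _), HZ as (He'' & Hc'' & _).
set (m := mate E e' f D c) in *. set (n := mate F e'' g E c') in *.
erewrite tens_compr by homt. erewrite (compA (h:=e)) by homt.
rewrite Em. erewrite <- compA by homt.
erewrite tens_exch' by homt.
erewrite <- (tens_exch (f:=n) (g:=f)) by homt.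
erewrite compA by homt. rewrite En.
erewrite <- compA by homt. now erewrite <- tens_compl by homt.
Qed.

Lemma is_dual_unit : is_dual 𝟙 𝟙 (idm 𝟙) (idm 𝟙).
Proof.
repeat split; [homt|homt| |];
  rewrite !tensm_id, comp_idl with (X := 𝟙 ⊗ 𝟙) by homt; f_equal; apply tens1l.
Qed.

Lemma is_dual_tens X D eX cX Y E eY cY :
  is_dual X D eX cX -> is_dual Y E eY cY ->
  is_dual (X ⊗ Y) (E ⊗ D) (ev_tens Y E eX eY) (coev_tens X D cX cY).
Proof.
intros (He & Hc & Hs & Hs') (He' & Hc' & Ht & Ht').
unfold ev_tens, coev_tens.
split; [homt|]. split; [homt|]. split.
- transitivity ((idm X ⊗' ((idm Y ⊗' eY) ∘ (cY ⊗' idm Y)))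
                ∘ (((idm X ⊗' eX) ∘ (cX ⊗' idm X)) ⊗' idm Y)).
  + generalize (exch X Y Hc' He). flat. intros H. f_equal.
    erewrite <- compA by homt. rewrite H. now erewrite compA by homt.
  + rewrite Hs, Ht, !tensm_id. now erewrite comp_idl by homt.
- transitivity (((eY ⊗' idm E ∘ idm E ⊗' cY) ⊗' idm D)
                ∘ (idm E ⊗' ((eX ⊗' idm D) ∘ (idm D ⊗' cX)))).
  + generalize (exch E D He Hc'). flat. intros H. f_equal.
    erewrite <- compA by homt. rewrite <- H. now erewrite compA by homt.
  + rewrite Hs', Ht', !tensm_id. now erewrite comp_idl by homt.
Qed.

Lemma mate_tens X D eX cX X' D' eX' cX' Y E eY cY Y' E' eY' cY' f g :
  is_dual X D eX cX -> is_dual X' D' eX' cX' ->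
  is_dual Y E eY cY -> is_dual Y' E' eY' cY' ->
  [f : X ~> X'] -> [g : Y ~> Y'] ->
  mate E' eY' g E cY ⊗' mate D' eX' f D cX
  = mate (E' ⊗ D') (ev_tens Y' E' eX' eY') (f ⊗' g)
         (E ⊗ D) (coev_tens X D cX cY).
Proof.
intros HX HX' HY HY' Hf Hg.
pose proof (mate_hom HX HX' Hf) as Hm. pose proof (mate_hom HY HY' Hg) as Hn.
pose proof (mate_ev HX HX' Hf) as Em. pose proof (mate_ev HY HY' Hg) as En.
apply (mate_unique (is_dual_tens HX HY) (is_dual_tens HX' HY')); [homt|homt|].
destruct HX as (He & Hc & _), HY as (He' & Hc' & _),
  HX' as (Ge & Gc & _), HY' as (Ge' & Gc' & _).
set (m := mate D' eX' f D cX) in *. set (n := mate E' eY' g E cY) in *.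
unfold ev_tens.
transitivity (eY ∘ (n ⊗' idm Y) ∘ (idm E' ⊗' (eX ∘ (m ⊗' idm X)) ⊗' idm Y)).
- erewrite <- (tens_exch (f:=n) (g:=m)) by homt.
  generalize (exch 𝟙 Y Hn He). flat. intros H. f_equal.
  erewrite <- compA by homt. rewrite H. now erewrite compA by homt.
- rewrite Em, En.
  erewrite <- (tens_exch' (f:=f) (g:=g)) by homt.
  generalize (exch E' 𝟙 Ge Hg). flat. intros H. f_equal.
  erewrite <- compA by homt. rewrite H. now erewrite compA by homt.
Qed.

Lemma mate_iso X D e c Y E e' c' f :
  is_dual X D e c -> is_dual Y E e' c' -> is_iso X Y f ->
  is_iso E D (mate E e' f D c).
Proof.
intros HX HY (Hf & g & Hg & Hgf & Hfg).
split; [exact (mate_hom HX HY Hf)|].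
exists (mate D e g E c'). split; [exact (mate_hom HY HX Hg)|]. split.
- rewrite (mate_comp HY HX HY Hg Hf), Hfg. exact (mate_id HY).
- rewrite (mate_comp HX HY HX Hf Hg), Hgf. exact (mate_id HX).
Qed.

Lemma dualm_hom X Y f : [f : X ~> Y] -> [dualm X Y f : Y^∨ ~> X^∨].
Proof. exact (mate_hom (is_dual_ldual X) (is_dual_ldual Y)). Qed.

Lemma dual_tens_iso X Y : is_iso (X ⊗ Y)^∨ (Y^∨ ⊗ X^∨) (dual_tens X Y).
Proof.
exact (mate_iso (is_dual_tens (is_dual_ldual X) (is_dual_ldual Y))
                (is_dual_ldual _) (is_iso_id _)).
Qed.

Lemma dual_tens_hom X Y : [dual_tens X Y : (X ⊗ Y)^∨ ~> Y^∨ ⊗ X^∨].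
Proof. apply dual_tens_iso. Qed.

Lemma dd_mult_iso X Y : is_iso (X^∨∨ ⊗ Y^∨∨) (X ⊗ Y)^∨∨ (dd_mult X Y).
Proof.
exact (mate_iso (is_dual_ldual _)
                (is_dual_tens (is_dual_ldual Y^∨) (is_dual_ldual X^∨))
                (dual_tens_iso X Y)).
Qed.

Lemma dd_mult_hom X Y : [dd_mult X Y : X^∨∨ ⊗ Y^∨∨ ~> (X ⊗ Y)^∨∨].
Proof. apply dd_mult_iso. Qed.

Lemma dual_unitE : mate 𝟙^∨ (evl 𝟙) (idm 𝟙) 𝟙 (idm 𝟙) = evl (𝟙 : Ob C).
Proof. unfold mate. flat. now erewrite !comp_idr by homt. Qed.

Lemma dual_unit_iso : is_iso 𝟙^∨ 𝟙 (evl (𝟙 : Ob C)).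
Proof.
rewrite <- dual_unitE.
exact (mate_iso is_dual_unit (is_dual_ldual _) (is_iso_id _)).
Qed.

Lemma dd_unit_iso : is_iso 𝟙 𝟙^∨∨ dd_unit.
Proof. exact (mate_iso (is_dual_ldual _) is_dual_unit dual_unit_iso). Qed.

Lemma dd_unit_hom : [dd_unit : 𝟙 ~> 𝟙^∨∨].
Proof. apply dd_unit_iso. Qed.

Lemma ddm_hom X Y f : [f : X ~> Y] -> [ddm X Y f : X^∨∨ ~> Y^∨∨].
Proof. intros Hf. now apply dualm_hom, dualm_hom. Qed.

Lemma dd_mult_nat X X' Y Y' f g : [f : X ~> X'] -> [g : Y ~> Y'] ->
  dd_mult X' Y' ∘ (ddm X X' f ⊗' ddm Y Y' g)
  = ddm (X ⊗ Y) (X' ⊗ Y') (f ⊗' g) ∘ dd_mult X Y.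
Proof.
intros Hf Hg.
pose proof (@is_dual_ldual) as S.
pose proof (fun X Y => is_dual_tens (S X) (S Y)) as T.
unfold ddm.
unfold dualm at 1. unfold dualm at 2.
rewrite (mate_tens (S _) (S _) (S _) (S _) (dualm_hom Hg) (dualm_hom Hf)).
unfold dd_mult.
rewrite (mate_comp (S _) (T _ _) (T _ _))
  by first [apply dual_tens_hom | apply tensm_hom; now apply dualm_hom].
unfold dualm at 3.
rewrite (mate_comp (S _) (S _) (T _ _)).
2:{ apply dualm_hom. homt. }
2:{ apply dual_tens_hom. }
f_equal. unfold dualm, dual_tens.
rewrite (mate_tens (S _) (S _) (S _) (S _) Hf Hg).
rewrite (mate_comp (T _ _) (T _ _) (S _)) by homt.
rewrite (mate_comp (T _ _) (S _) (S _)) by homt.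
f_equal. now erewrite comp_idl, comp_idr by homt.
Qed.

Lemma ev_tensA X D eX cX Y E eY cY Z F eZ cZ :
  is_dual X D eX cX -> is_dual Y E eY cY -> is_dual Z F eZ cZ ->
  ev_tens (Y ⊗ Z) (F ⊗ E) eX (ev_tens Z F eY eZ)
  = ev_tens Z F (ev_tens Y E eX eY) eZ.
Proof.
intros (He & Hc & _) (He' & Hc' & _) (He'' & Hc'' & _). unfold ev_tens.
now flat.
Qed.

Lemma coev_tensA X D eX cX Y E eY cY Z F eZ cZ :
  is_dual X D eX cX -> is_dual Y E eY cY -> is_dual Z F eZ cZ ->
  coev_tens X D cX (coev_tens Y E cY cZ)
  = coev_tens (X ⊗ Y) (E ⊗ D) (coev_tens X D cX cY) cZ.
Proof.
intros (He & Hc & _) (He' & Hc' & _) (He'' & Hc'' & _). unfold coev_tens.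
now flat.
Qed.

Lemma ev_tens1l Y E e c : is_dual Y E e c -> ev_tens Y E (idm 𝟙) e = e.
Proof.
intros (He & Hc & _). unfold ev_tens. flat.
rewrite tensm_id. now erewrite comp_idr by homt.
Qed.

Lemma ev_tens1r X D e c : is_dual X D e c -> ev_tens 𝟙 𝟙 e (idm 𝟙) = e.
Proof.
intros (He & Hc & _). unfold ev_tens. flat. now erewrite comp_idl by homt.
Qed.

Lemma coev_tens1l Y E e c : is_dual Y E e c -> coev_tens 𝟙 𝟙 (idm 𝟙) c = c.
Proof.
intros (He & Hc & _). unfold coev_tens. flat. now erewrite comp_idr by homt.
Qed.

Lemma coev_tens1r X D e c : is_dual X D e c -> coev_tens X D c (idm 𝟙) = c.
Proof.
intros (He & Hc & _). unfold coev_tens. flat.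
rewrite tensm_id. now erewrite comp_idl by homt.
Qed.

Lemma dd_multA X Y Z :
  dd_mult (X ⊗ Y) Z ∘ (dd_mult X Y ⊗' idm Z^∨∨)
  = dd_mult X (Y ⊗ Z) ∘ (idm X^∨∨ ⊗' dd_mult Y Z).
Proof.
pose proof (@is_dual_ldual) as S.
pose proof (fun X Y => is_dual_tens (S X) (S Y)) as T.
rewrite <- (mate_id (S Z^∨)), <- (mate_id (S X^∨)).
unfold dd_mult.
rewrite (mate_tens (S _) (S _) (S _) (T _ _) (idm_hom _) (dual_tens_hom _ _)).
rewrite (mate_tens (S _) (T _ _) (S _) (S _) (dual_tens_hom _ _) (idm_hom _)).
rewrite (mate_comp (S _) (T _ _) (is_dual_tens (S _) (T _ _)))
  by first [apply dual_tens_hom | apply tensm_hom; [homt|apply dual_tens_hom]].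
rewrite (mate_comp (S _) (T _ _) (is_dual_tens (T _ _) (S _)))
  by first [apply dual_tens_hom | apply tensm_hom; [apply dual_tens_hom|homt]].
rewrite (tensA X^∨∨), (tensA X), (ev_tensA (S _) (S _) (S _)).
f_equal.
unfold dual_tens.
rewrite <- (mate_id (S Z)), <- (mate_id (S X)).
rewrite (mate_tens (T _ _) (S _) (S _) (S _)) by homt.
rewrite (mate_tens (S _) (S _) (T _ _) (S _)) by homt.
rewrite (mate_comp (is_dual_tens (T _ _) (S _)) (T _ _) (S _)) by homt.
rewrite (mate_comp (is_dual_tens (S _) (T _ _)) (T _ _) (S _)) by homt.
rewrite (coev_tensA (S _) (S _) (S _)), !tensm_id, !tensA.
f_equal.
Qed.

Lemma dd_mult1l X : dd_mult 𝟙 X ∘ (dd_unit ⊗' idm X^∨∨) = idm X^∨∨.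
Proof.
pose proof (@is_dual_ldual) as S.
pose proof (fun X Y => is_dual_tens (S X) (S Y)) as T.
rewrite <- (mate_id (S X^∨)) at 1.
unfold dd_unit, dd_mult.
rewrite (mate_tens (S _) (S _) (S _) is_dual_unit (idm_hom _) (proj1 dual_unit_iso)).
rewrite (mate_comp (S _) (T _ _) (is_dual_tens (S _) is_dual_unit))
  by first [apply dual_tens_hom | homt].
rewrite (ev_tens1r (S _)), <- dual_unitE, <- (mate_id (S X)).
unfold dual_tens.
rewrite (mate_tens is_dual_unit (S _) (S _) (S _)) by homt.
rewrite (mate_comp (is_dual_tens is_dual_unit (S _)) (T _ _) (S _)) by homt.
rewrite (coev_tens1l (S _)), !tensm_id, comp_idl with (X := 𝟙 ⊗ X) by homt.
rewrite !tens1l, !tens1r, !(mate_id (S _)). reflexivity.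
Qed.

Lemma dd_mult1r X : dd_mult X 𝟙 ∘ (idm X^∨∨ ⊗' dd_unit) = idm X^∨∨.
Proof.
pose proof (@is_dual_ldual) as S.
pose proof (fun X Y => is_dual_tens (S X) (S Y)) as T.
rewrite <- (mate_id (S X^∨)) at 1.
unfold dd_unit, dd_mult.
rewrite (mate_tens (S _) is_dual_unit (S _) (S _) (proj1 dual_unit_iso) (idm_hom _)).
rewrite (mate_comp (S _) (T _ _) (is_dual_tens is_dual_unit (S _)))
  by first [apply dual_tens_hom | homt].
rewrite (ev_tens1l (S _)), <- dual_unitE, <- (mate_id (S X)).
unfold dual_tens.
rewrite (mate_tens (S _) (S _) is_dual_unit (S _)) by homt.
rewrite (mate_comp (is_dual_tens (S _) is_dual_unit) (T _ _) (S _)) by homt.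
rewrite (coev_tens1r (S _)), !tensm_id, comp_idl with (X := X ⊗ 𝟙) by homt.
rewrite !tens1l, !tens1r, !(mate_id (S _)). reflexivity.
Qed.

Definition dd_functor : functor C C.
Proof.
refine (@Functor C C (fun X => X^∨∨) ddm ddm_hom _ _).
- intros X. unfold ddm, dualm.
  now rewrite !(mate_id (is_dual_ldual _)).
- intros X Y Z g f Hg Hf. unfold ddm, dualm at 1 3 5.
  rewrite (mate_comp (is_dual_ldual _) (is_dual_ldual _) (is_dual_ldual _))
    by now apply dualm_hom.
  f_equal. unfold dualm. symmetry.
  exact (mate_comp (is_dual_ldual _) (is_dual_ldual _) (is_dual_ldual _) Hf Hg).
Defined.

Definition dd_monoidal : monoidal_functor C C :=
  @MonoidalFunctor C C dd_functor dd_mult dd_unit dd_mult_iso dd_unit_iso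
    dd_mult_nat dd_multA dd_mult1l dd_mult1r.

End Duality.

Section Conjugation.
Variables (C : rigid) (b : Ob C).
Hypothesis Hb : invertible b.

Definition conj_functor : functor C C.
Proof.
refine (@Functor C C (fun X => b ⊗ X ⊗ b^∨)
          (fun X Y f => idm b ⊗' f ⊗' idm b^∨) _ _ _).
- intros X Y f Hf. homt.
- intros X. now rewrite !tensm_id.
- intros X Y Z g f Hg Hf. now flat.
Defined.

(** The monoidal functor [b ⊗ - ⊗ b^∨], for an invertible object [b]. *)
Definition conj_monoidal : monoidal_functor C C.
Proof.
refine (@MonoidalFunctor C C conj_functor
  (fun X Y => idm b ⊗' idm X ⊗' evl b ⊗' idm Y ⊗' idm b^∨) (coevl b)
  _ _ _ _ _ _); simpl.
- intros X Y.
  refine (is_iso_cast (is_iso_tens (is_iso_tens (is_iso_tens (is_iso_tens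
    (is_iso_id b) (is_iso_id X)) (proj1 Hb)) (is_iso_id Y)) (is_iso_id b^∨)) _ _).
  all: objeq.
- exact (is_iso_cast (proj2 Hb) eq_refl (f_equal (fun x => x ⊗ b^∨) (eq_sym (tens1r b)))).
- intros X X' Y Y' f g Hf Hg.
  transitivity (idm b ⊗' f ⊗' evl b ⊗' g ⊗' idm b^∨).
  + transitivity ((idm b ⊗' idm X' ⊗' evl b ⊗' idm Y' ⊗' idm b^∨)
      ∘ (idm b ⊗' f ⊗' idm (b^∨ ⊗ b) ⊗' g ⊗' idm b^∨)).
    * now flat.
    * erewrite <- !tensm_comp by homt. erewrite !comp_idl, comp_idr by homt.
      reflexivity.
  + transitivity ((idm b ⊗' f ⊗' idm 𝟙 ⊗' g ⊗' idm b^∨)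
      ∘ (idm b ⊗' idm X ⊗' evl b ⊗' idm Y ⊗' idm b^∨)).
    * erewrite <- !tensm_comp by homt. erewrite !comp_idr, !comp_idl by homt.
      reflexivity.
    * now flat.
- intros X Y Z.
  assert (H : [evl b ⊗' idm Y : b^∨ ⊗ b ⊗ Y ~> Y]) by homt.
  generalize (exch (b ⊗ X) (Z ⊗ b^∨) H (evl_hom b)). now flat.
- intros X. transitivity (((idm b ⊗' evl b) ∘ (coevl b ⊗' idm b)) ⊗' idm X ⊗' idm b^∨).
  + now flat.
  + now rewrite snakel1, !tensm_id.
- intros X. transitivity (idm b ⊗' (idm X ⊗' ((evl b ⊗' idm b^∨) ∘ (idm b^∨ ⊗' coevl b)))).
  + now flat.
  + now rewrite snakel2, !tensm_id, tensA.
Defined.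
End Conjugation.

Record quasi_pivotal (C : rigid) := QuasiPivotal {
  qp_ob : Ob C;
  qp_inv : invertible qp_ob;
  qp_iso : Ob C -> Arr C;
  qp_isoP : is_monoidal_nat_iso (id_monoidal C)
              (comp_monoidal (conj_monoidal qp_inv) (dd_monoidal C)) qp_iso
}.

Record lmodule (M : monoidal) := LModule {
  lcat :> category;
  act : Ob M -> Ob lcat -> Ob lcat;
  actm : Arr M -> Arr lcat -> Arr lcat;
  actm_hom : forall X X' N N' f g, [f : X ~> X'] -> [g : N ~> N'] ->
    [actm f g : act X N ~> act X' N'];
  actm_id : forall X N, actm (idm X) (idm N) = idm (act X N);
  actm_comp : forall X X' X'' N N' N'' f' f g' g,
    [f' : X' ~> X''] -> [f : X ~> X'] -> [g' : N' ~> N''] -> [g : N ~> N'] ->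
    actm (f' ∘ f) (g' ∘ g) = actm f' g' ∘ actm f g;
  actA : forall X Y N, act X (act Y N) = act (X ⊗ Y) N;
  act1 : forall N, act 𝟙 N = N;
  actmA : forall X X' Y Y' N N' f g h,
    [f : X ~> X'] -> [g : Y ~> Y'] -> [h : N ~> N'] ->
    actm f (actm g h) = actm (f ⊗' g) h;
  actm1 : forall N N' f, [f : N ~> N'] -> actm (idm 𝟙) f = f
}.

Arguments act {M l} X N.
Arguments actm {M l} f g.

Notation "X ▷ N" := (act X N) (at level 39, right associativity) : cat_scope.
Notation "f ▷' g" := (actm f g) (at level 39, right associativity) : cat_scope.

(** The associativity and unit constraints of [P] and [Q] are equalities of
    objects, so both sides of [mdelta_tens] and [mdelta_unit] have the same source
    and target by [actA] and [act1]. *)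
Record module_functor (M : monoidal) (P Q : lmodule M) := ModuleFunctor {
  mdf :> functor P Q;
  mdelta : Ob M -> Ob P -> Arr Q;
  mdelta_iso : forall X N, is_iso (mdf (X ▷ N)) (X ▷ mdf N) (mdelta X N);
  mdelta_nat : forall X X' N N' f g, [f : X ~> X'] -> [g : N ~> N'] ->
    (f ▷' fmap mdf N N' g) ∘ mdelta X N
    = mdelta X' N' ∘ fmap mdf (X ▷ N) (X' ▷ N') (f ▷' g);
  mdelta_tens : forall X Y N,
    mdelta (X ⊗ Y) N = (idm X ▷' mdelta Y N) ∘ mdelta X (Y ▷ N);
  mdelta_unit : forall N, mdelta 𝟙 N = idm (mdf N)
}.

Definition module_equivalent (M : monoidal) (P Q : lmodule M) : Prop :=
  exists F : module_functor P Q, is_equivalence F.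

Definition regular_module (M : monoidal) : lmodule M :=
  @LModule M M (@tens M) (@tensm M) (@tensm_hom M) (@tensm_id M) (@tensm_comp M)
    (@tensA M) (@tens1l M) (@tensmA M) (@tensm1l M).

Section DrinfeldCentre.
Variable C : monoidal.

Record centre_ob := CentreOb {
  zob :> Ob C;
  zbr : Ob C -> Arr C;
  zbr_iso : forall Y, is_iso (zob ⊗ Y) (Y ⊗ zob) (zbr Y);
  zbr_nat : forall Y Y' f, [f : Y ~> Y'] ->
    (f ⊗' idm zob) ∘ zbr Y = zbr Y' ∘ (idm zob ⊗' f);
  zbr_tens : forall Y W, zbr (Y ⊗ W) = (idm Y ⊗' zbr W) ∘ (zbr Y ⊗' idm W)
}.

Lemma zbr_hom (X : centre_ob) Y : [zbr X Y : X ⊗ Y ~> Y ⊗ X].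
Proof. apply zbr_iso. Qed.

Lemma centre_ob_eq (X X' : centre_ob) :
  zob X = zob X' -> (forall Y, zbr X Y = zbr X' Y) -> X = X'.
Proof.
destruct X as [x s H1 H2 H3], X' as [x' s' H1' H2' H3']. simpl.
intros <- Hs. apply functional_extensionality in Hs. subst s'.
f_equal; apply proof_irrelevance.
Qed.

Definition centre_hom (X X' : centre_ob) (f : Arr C) : Prop :=
  [f : zob X ~> zob X'] /\
  forall Y, zbr X' Y ∘ (f ⊗' idm Y) = (idm Y ⊗' f) ∘ zbr X Y.

Definition centre_cat : category.
Proof.
refine (@Category centre_ob (Arr C) centre_hom (fun X => idm (zob X)) (@comp C)
          _ _ _ _ _).
- intros X. split; [homt|]. intros Y. pose proof (zbr_hom X Y).
  rewrite !tensm_id. now erewrite comp_idl, comp_idr by homt.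
- intros X Y Z g f (Hg & Eg) (Hf & Ef). split; [homt|].
  intros W. pose proof (zbr_hom X W). pose proof (zbr_hom Y W).
  pose proof (zbr_hom Z W).
  flat. rewrite Eg. erewrite <- !compA by homt. now rewrite Ef.
- intros X Y f (Hf & _). exact (comp_idl Hf).
- intros X Y f (Hf & _). exact (comp_idr Hf).
- intros W X Y Z h g f (Hh & _) (Hg & _) (Hf & _). exact (compA Hh Hg Hf).
Defined.

Hint Resolve zbr_hom : cat.

Definition centre_tens (X X' : centre_ob) : centre_ob.
Proof.
refine (@CentreOb (zob X ⊗ zob X')
  (fun Y => (zbr X Y ⊗' idm (zob X')) ∘ (idm (zob X) ⊗' zbr X' Y)) _ _ _).
- intros Y.
  refine (is_iso_comp (Y := X ⊗ Y ⊗ X') _ _).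
  + exact (is_iso_cast (is_iso_tens (zbr_iso X Y) (is_iso_id (zob X')))
             eq_refl (eq_sym (tensA _ _ _))).
  + exact (is_iso_cast (is_iso_tens (is_iso_id (zob X)) (zbr_iso X' Y))
             (tensA _ _ _) (tensA _ _ _)).
- intros Y Y' f Hf.
  transitivity (((f ⊗' idm X ∘ zbr X Y) ⊗' idm X') ∘ (idm X ⊗' zbr X' Y)).
  { now flat. }
  rewrite (zbr_nat X Hf).
  transitivity ((zbr X Y' ⊗' idm X') ∘ (idm X ⊗' (f ⊗' idm X' ∘ zbr X' Y))).
  { now flat. }
  rewrite (zbr_nat X' Hf). now flat.
- intros Y W. rewrite !zbr_tens.
  generalize (exch 𝟙 𝟙 (zbr_hom X Y) (zbr_hom X' W)). flat. intros H.
  erewrite <- (compA (f := idm X ⊗' idm Y ⊗' zbr X' W)) by homt.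
  rewrite <- H. now erewrite !compA by homt.
Defined.

Definition centre_unit : centre_ob.
Proof.
refine (@CentreOb 𝟙 (fun Y => idm Y) _ _ _).
- intros Y. refine (is_iso_cast (is_iso_id Y) _ _); now rewrite ?tens1l, ?tens1r.
- intros Y Y' f Hf. flat. now erewrite comp_idl, comp_idr by homt.
- intros Y W. rewrite tensm_id. symmetry. apply (comp_idl (idm_hom _)).
Defined.

Lemma centre_tensm_hom (X X' Y Y' : centre_ob) f g :
  centre_hom X X' f -> centre_hom Y Y' g ->
  centre_hom (centre_tens X Y) (centre_tens X' Y') (f ⊗' g).
Proof.
intros (Hf & Ef) (Hg & Eg). split; [simpl; homt|]. intros W. simpl.
pose proof (zbr_hom X W). pose proof (zbr_hom X' W).
pose proof (zbr_hom Y W). pose proof (zbr_hom Y' W).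
transitivity ((zbr X' W ⊗' idm Y') ∘ (f ⊗' (zbr Y' W ∘ (g ⊗' idm W)))).
{ assert (Hk : [zbr Y' W ∘ (g ⊗' idm W) : Y ⊗ W ~> W ⊗ Y']) by homt.
  rewrite <- (tens_exch Hf Hk), <- (tens_exch Hf Hg).
  generalize (exch 𝟙 𝟙 Hf (zbr_hom Y' W)). flat. intros E.
  f_equal. erewrite <- !compA by homt. now rewrite E. }
rewrite Eg.
assert (Hl : [(idm W ⊗' g) ∘ zbr Y W : Y ⊗ W ~> W ⊗ Y']) by homt.
assert (Hm : [zbr X' W ∘ (f ⊗' idm W) : X ⊗ W ~> W ⊗ X']) by homt.
transitivity (((zbr X' W ∘ (f ⊗' idm W)) ⊗' g) ∘ (idm X ⊗' zbr Y W)).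
{ rewrite <- (tens_exch Hf Hl), <- (tens_exch Hm Hg). now flat. }
rewrite Ef in *.
rewrite <- (tens_exch' Hm Hg), <- (tens_exch' Hf Hg). now flat.
Qed.

Definition drinfeld_centre : monoidal.
Proof.
refine (@Monoidal centre_cat centre_unit centre_tens (@tensm C)
          centre_tensm_hom _ _ _ _ _ _ _ _); simpl.
- intros X Y. apply tensm_id.
- intros X X' X'' Y Y' Y'' f' f g' g (Hf' & _) (Hf & _) (Hg' & _) (Hg & _).
  exact (tensm_comp Hf' Hf Hg' Hg).
- intros X Y Z. apply centre_ob_eq; simpl; [apply tensA|].
  intros W. pose proof (zbr_hom X W). pose proof (zbr_hom Y W).
  pose proof (zbr_hom Z W). now flat.
- intros X. apply centre_ob_eq; simpl; [apply tens1l|].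
  intros W. flat. rewrite tensm_id. erewrite comp_idl by homt. reflexivity.
- intros X. apply centre_ob_eq; simpl; [apply tens1r|].
  intros W. flat. rewrite tensm_id. erewrite comp_idr; [reflexivity|homt].
- intros X X' Y Y' Z Z' f g h (Hf & _) (Hg & _) (Hh & _). exact (tensmA Hf Hg Hh).
- intros X X' f (Hf & _). exact (tensm1l Hf).
- intros X X' f (Hf & _). exact (tensm1r Hf).
Defined.

End DrinfeldCentre.

#[export] Hint Resolve zbr_hom : cat.

Section AntiDrinfeldCentre.
Variable C : rigid.

(** Since the duals are an arbitrary choice, the canonical isomorphism
    [Y^∨∨ ⊗ W^∨∨ -> (Y ⊗ W)^∨∨], which is usually suppressed, appears explicitly
    in the hexagon axiom [abr_tens]. *)
Record anti_ob := AntiOb {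
  aob :> Ob C;
  abr : Ob C -> Arr C;
  abr_iso : forall Y, is_iso (aob ⊗ Y^∨∨) (Y ⊗ aob) (abr Y);
  abr_nat : forall Y Y' f, [f : Y ~> Y'] ->
    (f ⊗' idm aob) ∘ abr Y = abr Y' ∘ (idm aob ⊗' ddm Y Y' f);
  abr_tens : forall Y W,
    abr (Y ⊗ W) ∘ (idm aob ⊗' dd_mult Y W)
    = (idm Y ⊗' abr W) ∘ (abr Y ⊗' idm W^∨∨)
}.

Definition C_invertible (A : anti_ob) : Prop := invertible (aob A).

Lemma abr_hom (A : anti_ob) Y : [abr A Y : A ⊗ Y^∨∨ ~> Y ⊗ A].
Proof. apply abr_iso. Qed.

Hint Resolve abr_hom dd_mult_hom ddm_hom : cat.

Lemma anti_ob_eq (A A' : anti_ob) :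
  aob A = aob A' -> (forall Y, abr A Y = abr A' Y) -> A = A'.
Proof.
destruct A as [a s H1 H2 H3], A' as [a' s' H1' H2' H3']. simpl.
intros <- Hs. apply functional_extensionality in Hs. subst s'.
f_equal; apply proof_irrelevance.
Qed.

Definition anti_hom (A A' : anti_ob) (f : Arr C) : Prop :=
  [f : aob A ~> aob A'] /\
  forall Y, abr A' Y ∘ (f ⊗' idm Y^∨∨) = (idm Y ⊗' f) ∘ abr A Y.

Definition anti_cat : category.
Proof.
refine (@Category anti_ob (Arr C) anti_hom (fun A => idm (aob A)) (@comp C)
          _ _ _ _ _).
- intros A. split; [homt|]. intros Y. pose proof (abr_hom A Y).
  rewrite !tensm_id. now erewrite comp_idl, comp_idr by homt.
- intros A B D g f (Hg & Eg) (Hf & Ef). split; [homt|].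
  intros W. pose proof (abr_hom A W). pose proof (abr_hom B W).
  pose proof (abr_hom D W).
  flat. rewrite Eg. erewrite <- !compA by homt. now rewrite Ef.
- intros A B f (Hf & _). exact (comp_idl Hf).
- intros A B f (Hf & _). exact (comp_idr Hf).
- intros A B D E h g f (Hh & _) (Hg & _) (Hf & _). exact (compA Hh Hg Hf).
Defined.

Definition anti_act (X : centre_ob C) (A : anti_ob) : anti_ob.
Proof.
refine (@AntiOb (zob X ⊗ aob A)
  (fun Y => (zbr X Y ⊗' idm (aob A)) ∘ (idm (zob X) ⊗' abr A Y)) _ _ _).
- intros Y.
  refine (is_iso_comp (Y := X ⊗ Y ⊗ A) _ _).
  + exact (is_iso_cast (is_iso_tens (zbr_iso X Y) (is_iso_id (aob A)))
             eq_refl (eq_sym (tensA _ _ _))).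
  + exact (is_iso_cast (is_iso_tens (is_iso_id (zob X)) (abr_iso A Y))
             (tensA _ _ _) (tensA _ _ _)).
- intros Y Y' f Hf. pose proof (ddm_hom Hf).
  transitivity (((f ⊗' idm X ∘ zbr X Y) ⊗' idm A) ∘ (idm X ⊗' abr A Y)).
  { now flat. }
  rewrite (zbr_nat X Hf).
  transitivity ((zbr X Y' ⊗' idm A) ∘ (idm X ⊗' (f ⊗' idm A ∘ abr A Y))).
  { now flat. }
  rewrite (abr_nat A Hf). now flat.
- intros Y W.
  transitivity ((zbr X (Y ⊗ W) ⊗' idm A)
    ∘ (idm X ⊗' (abr A (Y ⊗ W) ∘ (idm A ⊗' dd_mult Y W)))).
  { now flat. }
  rewrite zbr_tens, abr_tens.
  generalize (exch 𝟙 𝟙 (zbr_hom X Y) (abr_hom A W)). flat. intros H.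
  erewrite <- (compA (f := idm X ⊗' idm Y ⊗' abr A W)) by homt.
  rewrite <- H. now erewrite !compA by homt.
Defined.

Lemma anti_actm_hom (X X' : centre_ob C) (A A' : anti_ob) f g :
  centre_hom X X' f -> anti_hom A A' g ->
  anti_hom (anti_act X A) (anti_act X' A') (f ⊗' g).
Proof.
intros (Hf & Ef) (Hg & Eg). split; [simpl; homt|]. intros W. simpl.
pose proof (zbr_hom X W). pose proof (zbr_hom X' W).
pose proof (abr_hom A W). pose proof (abr_hom A' W).
transitivity ((zbr X' W ⊗' idm A') ∘ (f ⊗' (abr A' W ∘ (g ⊗' idm W^∨∨)))).
{ assert (Hk : [abr A' W ∘ (g ⊗' idm W^∨∨) : A ⊗ W^∨∨ ~> W ⊗ A']) by homt.
  rewrite <- (tens_exch Hf Hk), <- (tens_exch Hf Hg).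
  generalize (exch 𝟙 𝟙 Hf (abr_hom A' W)). flat. intros E.
  f_equal. erewrite <- !compA by homt. now rewrite E. }
rewrite Eg.
assert (Hl : [(idm W ⊗' g) ∘ abr A W : A ⊗ W^∨∨ ~> W ⊗ A']) by homt.
assert (Hm : [zbr X' W ∘ (f ⊗' idm W) : X ⊗ W ~> W ⊗ X']) by homt.
transitivity (((zbr X' W ∘ (f ⊗' idm W)) ⊗' g) ∘ (idm X ⊗' abr A W)).
{ rewrite <- (tens_exch Hf Hl), <- (tens_exch Hm Hg). now flat. }
rewrite Ef in *.
rewrite <- (tens_exch' Hm Hg), <- (tens_exch' Hf Hg). now flat.
Qed.

Definition anti_drinfeld_centre : lmodule (drinfeld_centre C).
Proof.
refine (@LModule (drinfeld_centre C) anti_cat anti_act (@tensm C) anti_actm_hom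
          _ _ _ _ _ _); simpl.
- intros X A. apply tensm_id.
- intros X X' X'' Y Y' Y'' f' f g' g (Hf' & _) (Hf & _) (Hg' & _) (Hg & _).
  exact (tensm_comp Hf' Hf Hg' Hg).
- intros X Y A. apply anti_ob_eq; simpl; [apply tensA|].
  intros W. pose proof (zbr_hom X W). pose proof (zbr_hom Y W).
  pose proof (abr_hom A W). now flat.
- intros A. apply anti_ob_eq; simpl; [apply tens1l|].
  intros W. flat. rewrite tensm_id. erewrite comp_idl by homt. reflexivity.
- intros X X' Y Y' Z Z' f g h (Hf & _) (Hg & _) (Hh & _). exact (tensmA Hf Hg Hh).
- intros X X' f (Hf & _). exact (tensm1l Hf).
Defined.

End AntiDrinfeldCentre.

#[export] Hint Resolve abr_hom dd_mult_hom dd_unit_hom ddm_hom : cat.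

(* Main.v *)
From Stdlib Require Import IndefiniteDescription.
Require Import Defs.

Set Implicit Arguments.
Unset Strict Implicit.
Unset Printing Implicit Defensive.

(** For an invertible [b], a monoidal isomorphism [X -> b ⊗ X^∨∨ ⊗ b^∨] and the
    inverse of a half-braiding [X ⊗ b -> b ⊗ X^∨∨] determine each other by
    transposition along the duality of [b].

    For every object [A] of the anti-Drinfeld centre, [M ↦ M ⊗ A^∨] is right adjoint
    to [- ⊗ A] from the centre to the anti-Drinfeld centre, with unit [X ⊗ coevl A]
    and counit [M ⊗ evl A].  If [A] is invertible in [C], both are isomorphisms.
    Conversely, an equivalence [F] of module categories is isomorphic to [- ⊗ A]
    with [A = F 𝟙]; full faithfulness makes [coevl A] invertible, and the
    half-braidings of [A] and [A^∨] carry this over to [evl A]. *)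

(** * Inverses and cancellation of isomorphisms *)

Section Isomorphisms.
Variable C : category.
Implicit Types X Y Z : Ob C.

(** [is_iso] only asserts that an inverse exists. Inverse half-braidings are needed as data, so one
    is picked by description. *)
Definition inv X Y f (H : is_iso X Y f) : Arr C :=
  proj1_sig (constructive_indefinite_description _ (proj2 H)).

Section Inverse.
Variables (X Y : Ob C) (f : Arr C) (H : is_iso X Y f).

Lemma inv_hom : [inv H : Y ~> X].
Proof. unfold inv. now destruct constructive_indefinite_description as (g & ? & ? & ?). Qed.

Lemma inv_compl : inv H ∘ f = idm X.
Proof. unfold inv. now destruct constructive_indefinite_description as (g & ? & ? & ?). Qed.

Lemma inv_compr : f ∘ inv H = idm Y.
Proof. unfold inv. now destruct constructive_indefinite_description as (g & ? & ? & ?). Qed.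

Lemma inv_iso : is_iso Y X (inv H).
Proof.
split; [apply inv_hom|]. exists f.
split; [apply H|]. split; [apply inv_compr|apply inv_compl].
Qed.

Lemma iso_epi Z g h : [g : Y ~> Z] -> [h : Y ~> Z] -> g ∘ f = h ∘ f -> g = h.
Proof.
intros Hg Hh E. pose proof inv_hom as Hi.
rewrite <- (comp_idr Hg), <- (comp_idr Hh), <- inv_compr.
rewrite (compA Hg (proj1 H) Hi), (compA Hh (proj1 H) Hi). now rewrite E.
Qed.

Lemma iso_mono W g h : [g : W ~> X] -> [h : W ~> X] -> f ∘ g = f ∘ h -> g = h.
Proof.
intros Hg Hh E. pose proof inv_hom as Hi.
rewrite <- (comp_idl Hg), <- (comp_idl Hh), <- inv_compl.
rewrite <- (compA Hi (proj1 H) Hg), <- (compA Hi (proj1 H) Hh). now rewrite E.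
Qed.

End Inverse.

Lemma iso_intro X Y f g : [f : X ~> Y] -> [g : Y ~> X] -> g ∘ f = idm X ->
  f ∘ g = idm Y -> is_iso X Y f.
Proof. intros Hf Hg E E'. split; [assumption|]. now exists g. Qed.

Lemma is_iso_cancell X Y Z g f : is_iso Y Z g -> [f : X ~> Y] ->
  is_iso X Z (g ∘ f) -> is_iso X Y f.
Proof.
intros Hg Hf H. pose proof (proj1 Hg) as Hg'. pose proof (inv_hom Hg) as Hi.
replace f with (inv Hg ∘ (g ∘ f)).
- exact (is_iso_comp (inv_iso Hg) H).
- rewrite (compA Hi Hg' Hf), inv_compl. exact (comp_idl Hf).
Qed.

Lemma is_iso_cancelr X Y Z g f : is_iso X Y f -> [g : Y ~> Z] ->
  is_iso X Z (g ∘ f) -> is_iso Y Z g.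
Proof.
intros Hf Hg H. pose proof (proj1 Hf) as Hf'. pose proof (inv_hom Hf) as Hi.
replace g with (g ∘ f ∘ inv Hf).
- exact (is_iso_comp H (inv_iso Hf)).
- rewrite <- (compA Hg Hf' Hi), inv_compr. exact (comp_idr Hg).
Qed.

End Isomorphisms.

#[local] Hint Resolve inv_hom : cat.

(** * Transposition along the duality of an object *)

Section Rotation.
Variables (C : rigid) (A : Ob C).
Implicit Types Y Z : Ob C.

(** The transpose of [t : Y ⊗ A -> A ⊗ Z] in which both strands labelled [A] are bent round to the
    other side. *)
Definition rot Y Z (t : Arr C) : Arr C :=
  (evl A ⊗' idm Z ⊗' idm A^∨) ∘ (idm A^∨ ⊗' t ⊗' idm A^∨)
  ∘ (idm A^∨ ⊗' idm Y ⊗' coevl A).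

Lemma rot_hom Y Z t : [t : Y ⊗ A ~> A ⊗ Z] -> [rot Y Z t : A^∨ ⊗ Y ~> Z ⊗ A^∨].
Proof. intros Ht. unfold rot. homt. Qed.

Hint Resolve rot_hom : cat.

Lemma rot_ev Y Z t : [t : Y ⊗ A ~> A ⊗ Z] ->
  (idm Z ⊗' evl A) ∘ (rot Y Z t ⊗' idm A) = (evl A ⊗' idm Z) ∘ (idm A^∨ ⊗' t).
Proof.
intros Ht. unfold rot.
assert (Hs : [(evl A ⊗' idm Z) ∘ (idm A^∨ ⊗' t) : A^∨ ⊗ Y ⊗ A ~> Z]) by homt.
transitivity ((evl A ⊗' idm Z) ∘ (idm A^∨ ⊗' t)
   ∘ (idm A^∨ ⊗' (idm Y ⊗' ((idm A ⊗' evl A) ∘ (coevl A ⊗' idm A))))).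
(* An interchange law is put beside the goal so that [flat] expands both to the same form; the law
   then rewrites the goal. *)
- generalize (exch 𝟙 𝟙 Hs (evl_hom A)). flat. intros H.
 rewrite H. reflexivity.
- rewrite snakel1. flat. rewrite !tensm_id. now erewrite comp_idr by homt.
Qed.

Lemma rot_coev Y Z t : [t : Y ⊗ A ~> A ⊗ Z] ->
  (idm A ⊗' rot Y Z t) ∘ (coevl A ⊗' idm Y) = (t ⊗' idm A^∨) ∘ (idm Y ⊗' coevl A).
Proof.
intros Ht. unfold rot.
assert (Hs : [(t ⊗' idm A^∨) ∘ (idm Y ⊗' coevl A) : Y ~> A ⊗ Z ⊗ A^∨]) by homt.
transitivity ((((idm A ⊗' evl A) ∘ (coevl A ⊗' idm A)) ⊗' idm Z ⊗' idm A^∨)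
   ∘ ((t ⊗' idm A^∨) ∘ (idm Y ⊗' coevl A))).
- generalize (exch 𝟙 𝟙 (coevl_hom A) Hs). flat. intros H.
  erewrite <- !compA by homt. f_equal. revert H. erewrite <- !compA by homt. auto.
- rewrite snakel1, !tensm_id. erewrite comp_idl; [reflexivity|]. homt.
Qed.

(** The evaluation loses no information: bending [A] back with [coevl A] recovers [u] by the second
    snake identity. *)
Lemma rot_unique Y Z t u : [t : Y ⊗ A ~> A ⊗ Z] -> [u : A^∨ ⊗ Y ~> Z ⊗ A^∨] ->
  (idm Z ⊗' evl A) ∘ (u ⊗' idm A) = (evl A ⊗' idm Z) ∘ (idm A^∨ ⊗' t) ->
  u = rot Y Z t.
Proof.
intros Ht Hu E. unfold rot. symmetry.
transitivity ((((evl A ⊗' idm Z) ∘ (idm A^∨ ⊗' t)) ⊗' idm A^∨) ∘ (idm A^∨ ⊗' idm Y ⊗' coevl A)).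
{ now flat. }
rewrite <- E.
transitivity ((idm Z ⊗' ((evl A ⊗' idm A^∨) ∘ (idm A^∨ ⊗' coevl A))) ∘ u).
- generalize (exch 𝟙 𝟙 Hu (coevl_hom A)). flat. intros H.
  erewrite <- !compA by homt. f_equal. auto.
- rewrite snakel2, !tensm_id. now erewrite comp_idl by homt.
Qed.

Lemma rot_natl Y Z Z' t g : [t : Y ⊗ A ~> A ⊗ Z] -> [g : Z ~> Z'] ->
  (g ⊗' idm A^∨) ∘ rot Y Z t = rot Y Z' ((idm A ⊗' g) ∘ t).
Proof.
intros Ht Hg. unfold rot.
generalize (exch 𝟙 A^∨ (evl_hom A) Hg). flat. intros H. now rewrite H.
Qed.

Lemma rot_natr Y Y' Z t f : [t : Y' ⊗ A ~> A ⊗ Z] -> [f : Y ~> Y'] ->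
  rot Y' Z t ∘ (idm A^∨ ⊗' f) = rot Y Z (t ∘ (f ⊗' idm A)).
Proof.
intros Ht Hf. unfold rot.
generalize (exch A^∨ 𝟙 Hf (coevl_hom A)). flat. intros H.
erewrite <- !compA by homt. do 2 f_equal. auto.
Qed.

(** By [rot_unique] it suffices to evaluate against [A]. Two uses of [rot_ev] then carry the
    evaluation first past [t'] and then past [t]. *)
Lemma rot_tens Y Y' Z Z' t t' : [t : Y ⊗ A ~> A ⊗ Z] -> [t' : Y' ⊗ A ~> A ⊗ Z'] ->
  (idm Z ⊗' rot Y' Z' t') ∘ (rot Y Z t ⊗' idm Y')
  = rot (Y ⊗ Y') (Z ⊗ Z') ((t ⊗' idm Z') ∘ (idm Y ⊗' t')).
Proof.
intros Ht Ht'.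
pose proof (rot_hom Ht) as Hr. pose proof (rot_hom Ht') as Hr'.
pose proof (rot_ev Ht) as E. pose proof (rot_ev Ht') as E'.
apply rot_unique; [homt|homt|].
transitivity ((idm Z ⊗' ((idm Z' ⊗' evl A) ∘ (rot Y' Z' t' ⊗' idm A)))
   ∘ (rot Y Z t ⊗' idm Y' ⊗' idm A)).
{ now flat. }
rewrite E'.
transitivity (((idm Z ⊗' evl A) ∘ (rot Y Z t ⊗' idm A)) ⊗' idm Z' ∘ (idm A^∨ ⊗' (idm Y ⊗' t'))).
- generalize (exch 𝟙 𝟙 Hr Ht'). flat. intros H.
  erewrite <- !compA by homt. f_equal. auto.
- rewrite E. now flat.
Qed.

End Rotation.

#[local] Hint Resolve rot_hom : cat.

(** * The opposite half-braiding on the dual of an anti-Drinfeld object *)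

Section DualBraiding.
Variables (C : rigid) (A : anti_ob C).
Implicit Types X Y Z W : Ob C.

Definition abr_inv Y : Arr C := inv (abr_iso A Y).

Lemma abr_inv_hom Y : [abr_inv Y : Y ⊗ A ~> A ⊗ Y^∨∨].
Proof. apply inv_hom. Qed.

Hint Resolve abr_inv_hom : cat.

Lemma abr_inv_nat Y Y' f : [f : Y ~> Y'] ->
  (idm A ⊗' ddm Y Y' f) ∘ abr_inv Y = abr_inv Y' ∘ (f ⊗' idm A).
Proof.
intros Hf. pose proof (ddm_hom Hf) as Hdf.
apply (iso_mono (abr_iso A Y') (W := Y ⊗ A)); [homt|homt|].
erewrite !compA by homt. rewrite <- (abr_nat A Hf).
erewrite <- (compA (h := f ⊗' idm A)) by homt.
unfold abr_inv. rewrite !inv_compr.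
now erewrite comp_idr, comp_idl by homt.
Qed.

Lemma abr_inv_tens Y W :
  abr_inv (Y ⊗ W)
  = (idm A ⊗' dd_mult Y W) ∘ ((abr_inv Y ⊗' idm W^∨∨) ∘ (idm Y ⊗' abr_inv W)).
Proof.
apply (iso_mono (abr_iso A (Y ⊗ W)) (W := Y ⊗ W ⊗ A)); [homt|homt|].
unfold abr_inv at 1. rewrite inv_compr.
erewrite compA by homt. rewrite abr_tens.
transitivity ((idm Y ⊗' abr A W) ∘ ((abr A Y ∘ abr_inv Y) ⊗' idm W^∨∨) ∘ (idm Y ⊗' abr_inv W)).
- unfold abr_inv at 1. rewrite inv_compr.
  transitivity (idm Y ⊗' (abr A W ∘ abr_inv W)).
  + unfold abr_inv. now rewrite inv_compr, tensm_id, tensA.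
  + rewrite tensm_id. erewrite comp_idr by homt. now erewrite tens_compl by homt.
- now flat.
Qed.

(** The definition of [anti_ob] has no unit axiom; this one follows from the hexagon at [𝟙], [𝟙] by
    cancelling the invertible [abr A 𝟙]. *)
Lemma abr_unit : abr A 𝟙 ∘ (idm A ⊗' dd_unit C) = idm A.
Proof.
pose proof (abr_tens A 𝟙 𝟙) as E. rewrite !tens1l in E.
erewrite tensm1l in E by homt.
assert (E' : (idm A ⊗' dd_mult 𝟙 𝟙) = abr A 𝟙 ⊗' idm 𝟙^∨∨).
{ apply (iso_mono (abr_iso A 𝟙) (W := A ⊗ 𝟙^∨∨ ⊗ 𝟙^∨∨)); [|homt|assumption].
  eapply hom_cast; [typ|objeq|]. now rewrite !tens1l. }
(* Inserting [dd_unit] in the last factor turns the left side of [E'] into the identity, by the unit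
   law of [dd_mult], and the right side into a composite, by interchange. *)
assert (E2 : idm (A ⊗ 𝟙^∨∨) = (idm A ⊗' dd_unit C) ∘ abr A 𝟙).
{ transitivity ((idm A ⊗' dd_mult 𝟙 𝟙) ∘ (idm A ⊗' (idm 𝟙^∨∨ ⊗' dd_unit C))).
  - pose proof (dd_mult_hom (𝟙 : Ob C) 𝟙) as Hm. rewrite tens1l in Hm.
    erewrite <- tens_compl by homt.
    now rewrite dd_mult1r, tensm_id.
  - rewrite E'. generalize (exch 𝟙 𝟙 (abr_hom A 𝟙) (dd_unit_hom C)). now flat. }
assert (Hu : is_iso A (A ⊗ 𝟙^∨∨) (idm A ⊗' dd_unit C)).
{ refine (is_iso_cast (is_iso_tens (is_iso_id A) (dd_unit_iso C)) _ _); objeq. }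
pose proof (abr_hom A 𝟙) as Ha. rewrite tens1l in Ha.
apply (iso_mono Hu (W := A)); [homt|homt|].
erewrite compA by homt. rewrite <- E2. now erewrite comp_idl, comp_idr by homt.
Qed.

(** A half-braiding of [A^∨] that twists on the opposite side: composed with the
    one of an anti-Drinfeld object [M], it puts [M ⊗ A^∨] into the centre. *)
Definition dbr Y : Arr C := rot A Y Y^∨∨ (abr_inv Y).

Lemma dbr_hom Y : [dbr Y : A^∨ ⊗ Y ~> Y^∨∨ ⊗ A^∨].
Proof. apply rot_hom, abr_inv_hom. Qed.

Hint Resolve dbr_hom : cat.

Lemma dbr_nat Y Y' f : [f : Y ~> Y'] ->
  (ddm Y Y' f ⊗' idm A^∨) ∘ dbr Y = dbr Y' ∘ (idm A^∨ ⊗' f).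
Proof.
intros Hf. unfold dbr.
rewrite (rot_natl (abr_inv_hom Y) (ddm_hom Hf)), (rot_natr (abr_inv_hom Y') Hf).
now rewrite abr_inv_nat.
Qed.

Lemma dbr_tens Y W :
  dbr (Y ⊗ W)
  = (dd_mult Y W ⊗' idm A^∨) ∘ ((idm Y^∨∨ ⊗' dbr W) ∘ (dbr Y ⊗' idm W)).
Proof.
unfold dbr. rewrite (rot_tens (abr_inv_hom Y) (abr_inv_hom W)), abr_inv_tens.
erewrite rot_natl by homt. reflexivity.
Qed.

(** With [evl_ldual_mate], this makes duality data into mates, so that identities about them can be
    checked with [mate_comp]. *)
Lemma coevl_ldual_mate (Y : Ob C) :
  coevl Y^∨ = mate 𝟙 (idm 𝟙) (evl Y) (Y^∨ ⊗ Y^∨∨)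
                (coev_tens Y^∨ Y^∨∨ (coevl Y^∨) (coevl Y)).
Proof.
pose proof (@is_dual_ldual C) as S.
apply (mate_unique (is_dual_tens (S _) (S _)) (is_dual_unit C)); [homt|homt|].
unfold ev_tens. flat.
transitivity (evl Y ∘ (((idm Y^∨ ⊗' evl Y^∨) ∘ (coevl Y^∨ ⊗' idm Y^∨)) ⊗' idm Y)).
- flat. reflexivity.
- rewrite snakel1, !tensm_id. now erewrite comp_idr, comp_idl by homt.
Qed.

Lemma evl_ldual_mate (Y : Ob C) :
  evl Y^∨ = mate (Y^∨∨ ⊗ Y^∨) (ev_tens Y^∨ Y^∨∨ (evl Y) (evl Y^∨)) (coevl Y) 𝟙 (idm 𝟙).
Proof.
pose proof (@is_dual_ldual C) as S.
apply (mate_unique (is_dual_unit C) (is_dual_tens (S _) (S _))); [homt|homt|].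
unfold ev_tens. flat. erewrite comp_idl by homt.
transitivity (evl Y^∨ ∘ (idm Y^∨∨ ⊗' ((evl Y ⊗' idm Y^∨) ∘ (idm Y^∨ ⊗' coevl Y)))).
- rewrite snakel2, !tensm_id. now erewrite comp_idr by homt.
- flat. reflexivity.
Qed.

(** The double dual preserves evaluations, up to its monoidal constraints. Each side is a composite
    of mates that merges into one mate; comparing what is dualised, twice in a row, leaves only unit
    laws. *)
Lemma ddm_evl Y :
  ddm (Y^∨ ⊗ Y) 𝟙 (evl Y) ∘ dd_mult Y^∨ Y = dd_unit C ∘ evl Y^∨∨.
Proof.
pose proof (@is_dual_ldual C) as S.
pose proof (fun X Y => is_dual_tens (S X) (S Y)) as T.
pose proof (is_dual_unit C) as U.
pose proof (dualm_hom (evl_hom Y)) as He.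
rewrite evl_ldual_mate. unfold ddm, dd_unit, dd_mult.
unfold dualm at 1.
rewrite (mate_comp (S _) (S _) (T _ _)) by first [assumption | apply dual_tens_hom].
rewrite (mate_comp (S _) U (T _ _)) by homt.
f_equal.
unfold dualm, dual_tens.
rewrite (mate_comp (T _ _) (S _) (S _)) by homt.
transitivity (mate 𝟙 (idm 𝟙) (evl Y) (Y^∨ ⊗ Y^∨∨) (coev_tens Y^∨ Y^∨∨ (coevl Y^∨) (coevl Y))
  ∘ mate 𝟙^∨ (evl 𝟙) (idm 𝟙) 𝟙 (idm 𝟙)).
2:{ now rewrite <- coevl_ldual_mate, dual_unitE. }
rewrite (mate_comp (T _ _) U (S _)) by homt.
f_equal. now erewrite comp_idl, comp_idr by homt.
Qed.

(** The hexagon merges the two half-braidings into the one at [Y^∨ ⊗ Y]; naturality at [evl Y] moves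
    it to [𝟙], where it is trivial by [abr_unit]. This ties the half-braiding at [Y^∨] to the one at
    [Y]. *)
Lemma abr_evl Y :
  (evl Y ⊗' idm A) ∘ ((idm Y^∨ ⊗' abr A Y) ∘ (abr A Y^∨ ⊗' idm Y^∨∨))
  = idm A ⊗' evl Y^∨∨.
Proof.
pose proof (ddm_hom (evl_hom Y)) as Hd.
rewrite <- abr_tens. erewrite compA by homt.
rewrite (abr_nat A (evl_hom Y)).
erewrite <- compA by homt. erewrite <- tens_compl by homt. rewrite ddm_evl.
erewrite tens_compl by homt. erewrite compA by homt. rewrite abr_unit.
now erewrite comp_idl by homt.
Qed.

Lemma abr_inv_evl Y :
  (idm A ⊗' evl Y^∨∨) ∘ (abr_inv Y^∨ ⊗' idm Y^∨∨)
  = (evl Y ⊗' idm A) ∘ (idm Y^∨ ⊗' abr A Y).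
Proof.
rewrite <- abr_evl.
transitivity ((evl Y ⊗' idm A) ∘ (idm Y^∨ ⊗' abr A Y)
              ∘ ((abr A Y^∨ ∘ abr_inv Y^∨) ⊗' idm Y^∨∨)).
- now flat.
- unfold abr_inv. rewrite inv_compr, tensm_id. now erewrite comp_idr by homt.
Qed.

(** Mates of isomorphisms are isomorphisms, which makes [dbr Y^∨] invertible,
    and every object is a left dual up to isomorphism. *)
Lemma dbr_ldual Y :
  dbr Y^∨
  = mate (A^∨ ⊗ Y^∨) (ev_tens A A^∨ (evl Y) (evl A)) (abr A Y)
      (ldual Y^∨∨ ⊗ A^∨) (coev_tens A A^∨ (coevl A) (coevl Y^∨∨)).
Proof.
pose proof (@is_dual_ldual C) as S.
apply (mate_unique (is_dual_tens (S _) (S _)) (is_dual_tens (S _) (S _))); [homt|homt|].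
unfold ev_tens.
transitivity (evl Y^∨∨ ∘ (((idm (ldual Y^∨∨) ⊗' evl A) ∘ (dbr Y^∨ ⊗' idm A)) ⊗' idm Y^∨∨)).
{ now flat. }
unfold dbr at 1. rewrite (rot_ev (abr_inv_hom _)).
transitivity (evl A ∘ (idm A^∨ ⊗' ((idm A ⊗' evl Y^∨∨) ∘ (abr_inv Y^∨ ⊗' idm Y^∨∨)))).
- generalize (exch 𝟙 𝟙 (evl_hom A) (evl_hom Y^∨∨)). flat. intros H. now rewrite H.
- rewrite abr_inv_evl. now flat.
Qed.

Lemma dbr_ldual_iso Y : is_iso (A^∨ ⊗ Y^∨) (ldual Y^∨∨ ⊗ A^∨) (dbr Y^∨).
Proof.
pose proof (@is_dual_ldual C) as S.
rewrite dbr_ldual.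
exact (mate_iso (is_dual_tens (S _) (S _)) (is_dual_tens (S _) (S _)) (abr_iso A Y)).
Qed.

Lemma dualm_iso X Y (f : Arr C) : is_iso X Y f -> is_iso Y^∨ X^∨ (dualm X Y f).
Proof. exact (mate_iso (is_dual_ldual X) (is_dual_ldual Y)). Qed.

(** The snake identities make [X] a left dual of [rdual X], and the mate of the identity compares
    any two left duals. *)
Lemma rdual_ldual_iso X : exists f, is_iso X (rdual X)^∨ f.
Proof.
assert (H : is_dual (rdual X) X (evr X) (coevr X)).
{ repeat split; [homt|homt|apply snaker2|apply snaker1]. }
exists (mate X (evr X) (idm (rdual X)) (rdual X)^∨ (coevl (rdual X))).
exact (mate_iso (is_dual_ldual _) H (is_iso_id _)).
Qed.

(** The comparison above is used for [X] and for [rdual X], the latter dualised once. *)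
Lemma dd_surj X : exists Y f, is_iso Y^∨∨ X f.
Proof.
destruct (rdual_ldual_iso X) as [f Hf].
destruct (rdual_ldual_iso (rdual X)) as [g Hg].
exists (rdual (rdual X)), (inv Hf ∘ dualm (rdual X) (rdual (rdual X))^∨ g).
exact (is_iso_comp (inv_iso Hf) (dualm_iso Hg)).
Qed.

Lemma dbr_iso Y : is_iso (A^∨ ⊗ Y) (Y^∨∨ ⊗ A^∨) (dbr Y).
Proof.
destruct (rdual_ldual_iso Y) as [f Hf].
assert (Hdf : is_iso Y^∨∨ (ldual (rdual Y)^∨∨) (ddm Y (rdual Y)^∨ f)) by now apply dualm_iso, dualm_iso.
(* Naturality along [f] brings invertibility back from the left dual [(rdual Y)^∨] to [Y]. *)
apply (is_iso_cancell (is_iso_tens Hdf (is_iso_id A^∨))); [homt|].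
rewrite (dbr_nat (proj1 Hf)).
exact (is_iso_comp (dbr_ldual_iso _) (is_iso_tens (is_iso_id _) Hf)).
Qed.

Definition tens_ldual (M : anti_ob C) : centre_ob C.
Proof.
refine (@CentreOb C (aob M ⊗ A^∨)
  (fun Y => (abr M Y ⊗' idm A^∨) ∘ (idm M ⊗' dbr Y)) _ _ _).
- intros Y. apply is_iso_comp with (Y := M ⊗ Y^∨∨ ⊗ A^∨).
  + exact (is_iso_cast (is_iso_tens (abr_iso M Y) (is_iso_id A^∨))
             eq_refl (eq_sym (tensA _ _ _))).
  + exact (is_iso_cast (is_iso_tens (is_iso_id M) (dbr_iso Y))
             (tensA _ _ _) (tensA _ _ _)).
- intros Y Y' f Hf. pose proof (ddm_hom Hf).
  transitivity (((f ⊗' idm M ∘ abr M Y) ⊗' idm A^∨) ∘ (idm M ⊗' dbr Y)).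
  { now flat. }
  rewrite (abr_nat M Hf).
  transitivity ((abr M Y' ⊗' idm A^∨)
    ∘ (idm M ⊗' ((ddm Y Y' f ⊗' idm A^∨) ∘ dbr Y))).
  { now flat. }
  rewrite (dbr_nat Hf). now flat.
(* The constraint [dd_mult] produced on the side of [A^∨] is absorbed by the hexagon of [M], so no
   double dual is left. *)
- intros Y W. rewrite dbr_tens.
  transitivity (((abr M (Y ⊗ W) ∘ (idm M ⊗' dd_mult Y W)) ⊗' idm A^∨)
    ∘ (idm M ⊗' ((idm Y^∨∨ ⊗' dbr W) ∘ (dbr Y ⊗' idm W)))).
  { now flat. }
  rewrite abr_tens.
  generalize (f_equal (comp (idm Y ⊗' abr M W ⊗' idm A^∨))
    (exch 𝟙 𝟙 (abr_hom M Y) (dbr_hom W))). flat. intros H. now rewrite H.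
Defined.

End DualBraiding.

#[local] Hint Resolve dbr_hom abr_inv_hom : cat.

(** * Unit and counit as morphisms of the centres *)

Section Adjunction.
Variables (C : rigid) (A : anti_ob C).

Lemma tens_ldual_hom (M N : anti_ob C) f :
  anti_hom M N f ->
  centre_hom (tens_ldual A M) (tens_ldual A N) (f ⊗' idm A^∨).
Proof.
intros (Hf & Ef). split; [simpl; homt|]. intros Y. simpl.
transitivity (((abr N Y ∘ (f ⊗' idm Y^∨∨)) ⊗' idm A^∨) ∘ (idm M ⊗' dbr A Y)).
- generalize (f_equal (comp (abr N Y ⊗' idm A^∨)) (exch 𝟙 𝟙 Hf (dbr_hom A Y))). flat. intros H. now rewrite H.
- rewrite Ef. now flat.
Qed.

(** Sliding [dbr] along the coevaluation with [rot_coev] turns it into [abr_inv], which cancels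
    [abr]; the half-braiding of [X] then passes by interchange. *)
Lemma unit_centre_hom (X : centre_ob C) :
  centre_hom X (tens_ldual A (anti_act X A)) (idm X ⊗' coevl A).
Proof.
split; [simpl; homt|]. intros Y. simpl.
transitivity ((zbr X Y ⊗' idm A ⊗' idm A^∨) ∘
  (idm X ⊗' ((abr A Y ⊗' idm A^∨) ∘ ((idm A ⊗' dbr A Y) ∘ (coevl A ⊗' idm Y))))).
{ now flat. }
unfold dbr. rewrite (rot_coev (abr_inv_hom A Y)).
transitivity ((zbr X Y ⊗' idm A ⊗' idm A^∨) ∘
  (idm X ⊗' (((abr A Y ∘ abr_inv A Y) ⊗' idm A^∨) ∘ (idm Y ⊗' coevl A)))).
{ now flat. }
unfold abr_inv. rewrite inv_compr, !tensm_id. erewrite comp_idl by homt.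
generalize (exch 𝟙 𝟙 (zbr_hom X Y) (coevl_hom A)). flat. auto.
Qed.

(** Dual to the unit: [rot_ev] trades [dbr] for [abr_inv], which cancels [abr] on the source
    side. *)
Lemma counit_anti_hom (M : anti_ob C) :
  anti_hom (anti_act (tens_ldual A M) A) M (idm M ⊗' evl A).
Proof.
split; [simpl; homt|]. intros Y. simpl.
transitivity (abr M Y ∘ (idm M ⊗' ((evl A ⊗' idm Y^∨∨)
   ∘ (idm A^∨ ⊗' (abr_inv A Y ∘ abr A Y))))).
{ unfold abr_inv. rewrite inv_compl, tensm_id. erewrite comp_idr by homt. now flat. }
transitivity (abr M Y ∘ (idm M ⊗' ((evl A ⊗' idm Y^∨∨) ∘ (idm A^∨ ⊗' abr_inv A Y)
   ∘ (idm A^∨ ⊗' abr A Y)))).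
{ now flat. }
rewrite <- (rot_ev (abr_inv_hom A Y)). fold (dbr A Y).
generalize (exch 𝟙 𝟙 (abr_hom M Y) (evl_hom A)). flat. intros H. now rewrite H.
Qed.

End Adjunction.

(** * Tensoring with an invertible object as a module equivalence *)

Section Centres.
Variable C : rigid.

(** The inverse in [C] commutes with the half-braidings automatically, as is seen after composing
    with the isomorphism [idm W ⊗' f]. *)
Lemma centre_iso (X Y : centre_ob C) f : centre_hom X Y f ->
  is_iso (zob X) (zob Y) f -> is_iso (C := centre_cat C) X Y f.
Proof.
intros H (Hf & g & Hg & E & E'). split; [assumption|]. exists g.
split; [|now split]. split; [assumption|]. intros W.
assert (Hi : is_iso (W ⊗ X) (W ⊗ Y) (idm W ⊗' f)).
{ apply is_iso_tens; [apply is_iso_id|]. split; [assumption|]. now exists g. }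
apply (iso_mono Hi (W := Y ⊗ W)); [homt|homt|].
erewrite !compA by homt. rewrite <- (proj2 H W).
transitivity (zbr Y W ∘ ((f ∘ g) ⊗' idm W)); [now flat|].
transitivity ((idm W ⊗' (f ∘ g)) ∘ zbr Y W); [|now flat].
rewrite E', !tensm_id. now erewrite comp_idl, comp_idr by homt.
Qed.

Lemma anti_iso (A B : anti_ob C) f : anti_hom A B f ->
  is_iso (aob A) (aob B) f -> is_iso (C := anti_cat C) A B f.
Proof.
intros H (Hf & g & Hg & E & E'). split; [assumption|]. exists g.
split; [|now split]. split; [assumption|]. intros W.
assert (Hi : is_iso (W ⊗ A) (W ⊗ B) (idm W ⊗' f)).
{ apply is_iso_tens; [apply is_iso_id|]. split; [assumption|]. now exists g. }
apply (iso_mono Hi (W := B ⊗ W^∨∨)); [homt|homt|].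
erewrite !compA by homt. rewrite <- (proj2 H W).
transitivity (abr B W ∘ ((f ∘ g) ⊗' idm W^∨∨)); [now flat|].
transitivity ((idm W ⊗' (f ∘ g)) ∘ abr B W); [|now flat].
rewrite E', !tensm_id. now erewrite comp_idl, comp_idr by homt.
Qed.

Variable A : anti_ob C.

Definition act_functor : functor (centre_cat C) (anti_cat C).
Proof.
refine (@Functor (centre_cat C) (anti_cat C) (fun X => anti_act X A)
  (fun _ _ f => f ⊗' idm A) _ _ _).
- intros X Y f Hf. apply anti_actm_hom; [assumption|apply (idm_hom (c := anti_cat C))].
- intros X. apply tensm_id.
- intros X Y Z g f (Hg & _) (Hf & _). exact (tens_compr _ Hg Hf).
Defined.

Definition tens_ldual_functor : functor (anti_cat C) (centre_cat C).
Proof.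
refine (@Functor (anti_cat C) (centre_cat C) (tens_ldual A)
  (fun _ _ f => f ⊗' idm A^∨) _ _ _).
- intros M N f. apply tens_ldual_hom.
- intros M. apply tensm_id.
- intros M N P g f (Hg & _) (Hf & _). exact (tens_compr _ Hg Hf).
Defined.

Lemma act_functor_equivalence : C_invertible A -> is_equivalence act_functor.
Proof.
intros [Hev Hcoev]. exists tens_ldual_functor. split.
- exists (fun X => idm (zob X) ⊗' coevl A). split.
  + intros X. apply centre_iso; [apply unit_centre_hom|].
    exact (is_iso_cast (is_iso_tens (is_iso_id (zob X)) Hcoev) (tens1r _) (tensA _ _ _)).
  + intros X Y f (Hf & _). simpl.
    generalize (exch 𝟙 𝟙 Hf (coevl_hom A)). flat. auto.
- exists (fun M => idm (aob M) ⊗' evl A). split.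
  + intros M. apply anti_iso; [apply counit_anti_hom|].
    exact (is_iso_cast (is_iso_tens (is_iso_id (aob M)) Hev) (tensA _ _ _) (tens1r _)).
  + intros M N f (Hf & _). simpl.
    generalize (exch 𝟙 𝟙 Hf (evl_hom A)). flat. auto.
Qed.

(** Strictness makes [(X ⊗ N) ⊗ A] and [X ⊗ (N ⊗ A)] the same object of the anti-Drinfeld centre, so
    the module constraint is an identity. *)
Definition act_module_functor :
  module_functor (regular_module (drinfeld_centre C)) (anti_drinfeld_centre C).
Proof.
refine (@ModuleFunctor _ (regular_module (drinfeld_centre C)) (anti_drinfeld_centre C)
  act_functor (fun X N => idm (zob X ⊗ zob N ⊗ A)) _ _ _ _).
- intros X N.
  refine (is_iso_cast (is_iso_id (_ : Ob (anti_cat C))) eq_refl _).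
  symmetry. apply (actA (l := anti_drinfeld_centre C)).
- intros X X' N N' f g (Hf & _) (Hg & _). simpl.
  erewrite comp_idl, comp_idr by homt. now flat.
- intros X Y N. simpl. rewrite tensm_id, !tensA. now erewrite comp_idl by homt.
- intros N. simpl. now rewrite tens1l.
Defined.

End Centres.

(** * Equivalences are fully faithful *)

Lemma nat_iso_inv (C D : category) (F G : functor C D) eta (H : is_nat_iso F G eta) :
  is_nat_iso G F (fun X => inv (proj1 H X)).
Proof.
split; [intros X; apply inv_iso|]. intros X Y f Hf. destruct H as (Heta & Neta). simpl.
pose proof (fmap_hom F Hf) as HFf. pose proof (fmap_hom G Hf) as HGf.
pose proof (proj1 (Heta X)) as HX. pose proof (proj1 (Heta Y)) as HY.
pose proof (inv_hom (Heta X)) as HX'. pose proof (inv_hom (Heta Y)) as HY'.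
apply (iso_mono (Heta Y) (W := G X)); [homt|homt|].
erewrite !compA by homt. rewrite <- (Neta _ _ _ Hf), inv_compr.
erewrite <- compA by homt. rewrite inv_compr.
now erewrite comp_idl, comp_idr by homt.
Qed.

Section FullyFaithful.
Variables (C D : category) (F : functor C D).
Hypothesis HF : is_equivalence F.

Lemma equivalence_faithful X Y f g : [f : X ~> Y] -> [g : X ~> Y] ->
  fmap F X Y f = fmap F X Y g -> f = g.
Proof.
destruct HF as (G & (eta & Heta & Neta) & _). intros Hf Hg E.
apply (iso_mono (Heta Y) Hf Hg).
pose proof (Neta X Y f Hf) as Ef. pose proof (Neta X Y g Hg) as Eg. simpl in *.
now rewrite <- Ef, <- Eg, E.
Qed.
End FullyFaithful.

(** The preimage is [G g] conjugated by [eta]. Its image under [F] is compared with [g] after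
    applying [G], which is faithful because it is an equivalence too. *)
Lemma equivalence_full (C D : category) (F : functor C D) X Y g :
  is_equivalence F -> [g : F X ~> F Y] ->
  exists f, [f : X ~> Y] /\ fmap F X Y f = g.
Proof.
intros (G & (eta & Heta & Neta) & (eps & Heps & Neps)) Hg.
assert (HG : is_equivalence G).
{ exists F. split.
  - eexists. exact (nat_iso_inv (conj Heps Neps)).
  - eexists. exact (nat_iso_inv (conj Heta Neta)). }
pose proof (proj1 (Heta X)) as HX. pose proof (inv_hom (Heta Y)) as HY. simpl in *.
pose proof (fmap_hom G Hg) as HGg.
assert (Hf : [inv (Heta Y) ∘ (fmap G (F X) (F Y) g ∘ eta X) : X ~> Y]).
{ exact (comp_hom HY (comp_hom HGg HX)). }
exists (inv (Heta Y) ∘ (fmap G (F X) (F Y) g ∘ eta X)). split; [exact Hf|].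
apply (equivalence_faithful HG (fmap_hom F Hf) Hg).
apply (iso_epi (Heta X) (Z := G (F Y))); [now apply fmap_hom, fmap_hom|assumption|].
pose proof (Neta X Y _ Hf) as E. simpl in E. rewrite E.
rewrite (compA (proj1 (Heta Y)) HY (comp_hom HGg HX)), inv_compr.
exact (comp_idl (comp_hom HGg HX)).
Qed.

(** * Invertibility of evaluation and coevaluation *)

Section Invertibility.
Variables (C : rigid) (A : anti_ob C).

(** [dbr] and [abr] identify [evl A ⊗' idm Y^∨∨] with [idm Y^∨∨ ⊗' evl A].  For
    [Y^∨∨] isomorphic to [A] the latter is invertible, by the snake identity;
    tensoring with [A^∨] on the right and cancelling [A ⊗ A^∨] leaves [evl A]. *)
Lemma evl_iso_of_coevl_iso :
  is_iso 𝟙 (A ⊗ A^∨) (coevl A) -> is_iso (A^∨ ⊗ A) 𝟙 (evl A).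
Proof.
intros Hc.
assert (Hr : is_iso (A ⊗ A^∨ ⊗ A) A (idm A ⊗' evl A)).
{ apply (is_iso_cancelr (X := A) (f := coevl A ⊗' idm A)).
  - refine (is_iso_cast (is_iso_tens Hc (is_iso_id A)) _ _); objeq.
  - homt.
  - rewrite snakel1. apply is_iso_id. }
destruct (dd_surj (aob A)) as (Y & f & Hf).
pose proof (proj1 Hf) as Hf'.
assert (HY : is_iso (Y^∨∨ ⊗ A^∨ ⊗ A) Y^∨∨ (idm Y^∨∨ ⊗' evl A)).
{ apply (is_iso_cancell Hf); [homt|].
  replace (f ∘ (idm Y^∨∨ ⊗' evl A)) with ((idm A ⊗' evl A) ∘ (f ⊗' idm A^∨ ⊗' idm A)).
  - refine (is_iso_comp Hr (is_iso_tens (is_iso_tens Hf (is_iso_id _)) (is_iso_id _))).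
  - generalize (exch 𝟙 𝟙 Hf' (evl_hom A)). now flat. }
assert (HY' : is_iso (A^∨ ⊗ A ⊗ Y^∨∨) Y^∨∨ (evl A ⊗' idm Y^∨∨)).
{ replace (evl A ⊗' idm Y^∨∨) with
    ((idm Y^∨∨ ⊗' evl A) ∘ (dbr A Y ⊗' idm A) ∘ (idm A^∨ ⊗' abr A Y)).
  - refine (is_iso_comp (is_iso_comp HY (is_iso_tens (dbr_iso A Y) (is_iso_id _))) _).
    refine (is_iso_cast (is_iso_tens (is_iso_id A^∨) (abr_iso A Y)) _ _); objeq.
  - unfold dbr. rewrite (rot_ev (abr_inv_hom A Y)).
    transitivity ((evl A ⊗' idm Y^∨∨) ∘ (idm A^∨ ⊗' (abr_inv A Y ∘ abr A Y))).
    + now flat.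
    + unfold abr_inv. rewrite inv_compl, tensm_id. now erewrite comp_idr by homt. }
assert (HA : is_iso (A^∨ ⊗ A ⊗ A) A (evl A ⊗' idm A)).
{ apply (is_iso_cancelr (X := A^∨ ⊗ A ⊗ Y^∨∨) (f := idm A^∨ ⊗' idm A ⊗' f)).
  - exact (is_iso_tens (is_iso_tens (is_iso_id _) (is_iso_id _)) Hf).
  - homt.
  - replace ((evl A ⊗' idm A) ∘ (idm A^∨ ⊗' idm A ⊗' f)) with (f ∘ (evl A ⊗' idm Y^∨∨)).
    + exact (is_iso_comp Hf HY').
    + generalize (exch 𝟙 𝟙 (evl_hom A) Hf'). now flat. }
apply (is_iso_cancell Hc); [homt|].
replace (coevl A ∘ evl A) with ((evl A ⊗' idm A ⊗' idm A^∨) ∘ (idm A^∨ ⊗' idm A ⊗' coevl A)).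
- refine (is_iso_comp (is_iso_tens HA (is_iso_id A^∨)) _).
  refine (is_iso_cast (is_iso_tens (is_iso_tens (is_iso_id A^∨) (is_iso_id A)) Hc) _ _); objeq.
- generalize (exch 𝟙 𝟙 (evl_hom A) (coevl_hom A)). now flat.
Qed.

(** [r] exists because [- ⊗ A] is full; it is a left inverse of [coevl A] by
    faithfulness and a right inverse by a snake identity. *)
Lemma coevl_iso_of_retraction r :
  centre_hom (tens_ldual A A) (centre_unit C) r ->
  r ⊗' idm A = idm A ⊗' evl A ->
  (forall f, centre_hom (centre_unit C) (centre_unit C) f ->
     f ⊗' idm A = idm A -> f = idm 𝟙) ->
  is_iso 𝟙 (A ⊗ A^∨) (coevl A).
Proof.
intros Hr E Hff. pose proof (proj1 Hr) as Hr'. simpl in Hr'.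
apply (iso_intro (g := r)); [homt|homt| |].
- apply Hff.
  + apply (comp_hom (c := centre_cat C) (Y := tens_ldual A A)); [assumption|].
    pose proof (unit_centre_hom A (centre_unit C)) as H. simpl in H.
    erewrite tensm1l in H by homt.
    assert (E1 : anti_act (centre_unit C) A = A).
    { exact (act1 (l := anti_drinfeld_centre C) A). }
    rewrite E1 in H. exact H.
  + erewrite tens_compr by homt. rewrite E. apply snakel1.
- transitivity ((r ⊗' idm A ⊗' idm A^∨) ∘ (idm A ⊗' idm A^∨ ⊗' coevl A)).
  + generalize (exch 𝟙 𝟙 Hr' (coevl_hom A)). now flat.
  + rewrite E. transitivity (idm A ⊗' ((evl A ⊗' idm A^∨) ∘ (idm A^∨ ⊗' coevl A))).
    * now flat.
    * now rewrite snakel2, tensm_id.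
Qed.
End Invertibility.

(** * Module equivalences and invertible objects *)

Section ModuleEquivalence.
Variable C : rigid.

Lemma module_equivalent_of_invertible (A : anti_ob C) : C_invertible A ->
  module_equivalent (regular_module (drinfeld_centre C)) (anti_drinfeld_centre C).
Proof. intros H. exists (act_module_functor A). exact (act_functor_equivalence H). Qed.

Lemma invertible_of_module_equivalent :
  module_equivalent (regular_module (drinfeld_centre C)) (anti_drinfeld_centre C) ->
  exists A : anti_ob C, C_invertible A.
Proof.
intros (F & HF). simpl in F.
set (U := centre_unit C). set (A := F U : anti_ob C). exists A.
assert (HU : forall X : centre_ob C, centre_tens X U = X).
{ exact (tens1r (m := drinfeld_centre C)). }
assert (HA : anti_act U A = A).
{ exact (act1 (l := anti_drinfeld_centre C) A). }
(* Since [X ⊗ U = X] in the centre, the module constraint at [U] is a natural isomorphism from [F]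
   to [- ⊗ A], equal to the identity at [U]. *)
pose (d := fun X => mdelta F X U : Arr C).
assert (Hd : forall X : centre_ob C, is_iso (C := anti_cat C) (F X) (anti_act X A) (d X)).
{ intros X. pose proof (mdelta_iso F X U) as H. simpl in H.
  rewrite HU in H. exact H. }
assert (HdU : d U = idm A). { exact (mdelta_unit F U). }
assert (Nd : forall X Y f, centre_hom X Y f -> (f ⊗' idm A) ∘ d X = d Y ∘ fmap F X Y f).
{ intros X Y f Hf.
  pose proof (mdelta_nat F Hf (idm_hom (c := centre_cat C) U)) as H.
  simpl in H. rewrite !HU in H.
  pose proof (fmap_id F U) as Hi. simpl in Hi. rewrite Hi in H.
  erewrite tensm1r in H by exact (proj1 Hf). exact H. }
assert (Hc : is_iso 𝟙 (A ⊗ A^∨) (coevl A)).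
{ set (X := tens_ldual A A).
  pose proof (counit_anti_hom A A) as He. fold X in He.
  (* [r] is the preimage under [F] of the counit at [A], transported along [d X]. *)
  destruct (equivalence_full (C := centre_cat C) (D := anti_cat C) (X := X) (Y := U) (g := (idm A ⊗' evl A) ∘ d X) HF) as (r & Hr & E).
  { exact (comp_hom (c := anti_cat C) He (proj1 (Hd X))). }
  assert (Hr' := Hr). destruct Hr' as [Hr1 _]. simpl in Hr1.
  apply (coevl_iso_of_retraction Hr).
  (* After precomposing with [d X], naturality of [d] at [r] and [d U = idm A] turn [r ⊗' idm A]
     into [F r], which is the transported counit. *)
  - apply (iso_epi (Hd X) (Z := A)).
    + rewrite <- HA at 2.
      exact (anti_actm_hom Hr (idm_hom (c := anti_cat C) A)).
    + exact He.
    + refine (eq_trans (Nd _ _ _ Hr) (eq_trans (f_equal2 (@comp C) HdU E) _)).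
      exact (comp_idl (comp_hom (c := anti_cat C) He (proj1 (Hd X)))).
  (* Naturality of [d] at [U], where [d] is the identity, turns [f ⊗' idm A = idm A] into equality
     of [F f] and [F (idm U)]. *)
  - intros f Hf Ef.
    apply (equivalence_faithful (C := centre_cat C) (D := anti_cat C) HF (X := U) (Y := U) Hf (idm_hom (c := centre_cat C) U)).
    refine (eq_trans (eq_sym (comp_idl (c := anti_cat C) (fmap_hom F Hf))) _).
    refine (eq_trans (f_equal2 (@comp C) (eq_sym HdU) eq_refl) _).
    refine (eq_trans (eq_sym (Nd _ _ _ Hf)) _).
    refine (eq_trans (f_equal2 (@comp C) Ef HdU) _).
    exact (eq_trans (comp_idl (idm_hom (aob A))) (eq_sym (fmap_id F U))). }
split; [|exact Hc]. now apply evl_iso_of_coevl_iso.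
Qed.

End ModuleEquivalence.

(** * Quasi-pivotal structures and invertible objects *)

Section QuasiPivotal.
Variable C : rigid.

(** The half-braiding is specified by its inverse [t], the direction obtained by transposing a
    quasi-pivotal structure. *)
Definition anti_of_inverse (b : Ob C) (t : Ob C -> Arr C)
  (Ht : forall Y, is_iso (Y ⊗ b) (b ⊗ Y^∨∨) (t Y))
  (Nt : forall Y Y' f, [f : Y ~> Y'] ->
    (idm b ⊗' ddm Y Y' f) ∘ t Y = t Y' ∘ (f ⊗' idm b))
  (Tt : forall Y W, t (Y ⊗ W)
    = (idm b ⊗' dd_mult Y W) ∘ ((t Y ⊗' idm W^∨∨) ∘ (idm Y ⊗' t W))) :
  anti_ob C.
Proof.
assert (Hm : forall Y, [t Y : Y ⊗ b ~> b ⊗ Y^∨∨]) by (intros Y; apply Ht).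
assert (Hi : forall Y, [inv (Ht Y) : b ⊗ Y^∨∨ ~> Y ⊗ b]) by (intros Y; apply inv_hom).
refine (@AntiOb C b (fun Y => inv (Ht Y)) (fun Y => inv_iso (Ht Y)) _ _).
- intros Y Y' f Hf. pose proof (ddm_hom Hf) as Hdf.
  apply (iso_mono (Ht Y') (W := b ⊗ Y^∨∨)); [homt|homt|].
  erewrite !compA by homt. rewrite <- (Nt _ _ _ Hf), inv_compr.
  erewrite <- compA by homt. rewrite inv_compr.
  now erewrite comp_idl, comp_idr by homt.
- intros Y W.
  apply (iso_mono (Ht (Y ⊗ W)) (W := b ⊗ Y^∨∨ ⊗ W^∨∨)); [homt|homt|].
  erewrite !compA by homt. rewrite inv_compr, Tt.
  erewrite comp_idl by homt.
  (* The hexagon of [t] meets the inverses in reverse order: [t W] cancels first, then [t Y]. *)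
  transitivity ((idm b ⊗' dd_mult Y W) ∘ ((t Y ⊗' idm W^∨∨) ∘ (idm Y ⊗' (t W ∘ inv (Ht W)))
     ∘ (inv (Ht Y) ⊗' idm W^∨∨))).
  + rewrite inv_compr, tensm_id.
    transitivity ((idm b ⊗' dd_mult Y W) ∘ ((t Y ∘ inv (Ht Y)) ⊗' idm W^∨∨)).
    * rewrite inv_compr, tensm_id. now erewrite comp_idr by homt.
    * erewrite (comp_idr (f := t Y ⊗' idm W^∨∨)) by homt. now flat.
  + now flat.
Defined.

Lemma invertible_of_quasi_pivotal : quasi_pivotal C ->
  exists A : anti_ob C, C_invertible A.
Proof.
intros [b Hb rho [[Hr Nr] [Mr _]]]. simpl in Hr, Nr, Mr.
assert (Hh : forall Y, [rho Y : Y ~> b ⊗ Y^∨∨ ⊗ b^∨]) by (intros Y; apply Hr).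
(* The transpose of [rho Y]: its strand [b^∨] is evaluated against a new [b] in the source. *)
pose (t := fun Y => (idm b ⊗' idm Y^∨∨ ⊗' evl b) ∘ (rho Y ⊗' idm b)).
assert (Ht : forall Y, is_iso (Y ⊗ b) (b ⊗ Y^∨∨) (t Y)).
{ intros Y. apply is_iso_comp with (Y := b ⊗ Y^∨∨ ⊗ b^∨ ⊗ b).
  - refine (is_iso_cast (is_iso_tens (is_iso_tens (is_iso_id b) (is_iso_id Y^∨∨)) (proj1 Hb)) _ _); objeq.
  - exact (is_iso_tens (Hr Y) (is_iso_id b)). }
unshelve eexists (anti_of_inverse (b := b) (t := t) Ht _ _).
- intros Y Y' f Hf. pose proof (ddm_hom Hf) as Hdf. unfold t.
  transitivity ((idm b ⊗' idm Y'^∨∨ ⊗' evl b) ∘ ((rho Y' ∘ f) ⊗' idm b)); [|now flat].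
  rewrite <- (Nr _ _ _ Hf).
  generalize (exch b 𝟙 Hdf (evl_hom b)). flat. intros H. now rewrite H.
- intros Y W. unfold t.
  (* The multiplication of the target contracts the inner [b^∨ ⊗ b], as does composing [t W] with
     [t Y]; interchange matches the two. *)
  specialize (Mr Y W). erewrite comp_idr in Mr by homt. rewrite Mr.
  rewrite <- (tens_exch (Hh Y) (Hh W)).
  assert (Hp : [t Y : Y ⊗ b ~> b ⊗ Y^∨∨]) by apply Ht. unfold t in Hp.
  assert (He : [idm W^∨∨ ⊗' evl b : W^∨∨ ⊗ b^∨ ⊗ b ~> W^∨∨]) by homt.
  generalize (exch b 𝟙 (dd_mult_hom Y W) (evl_hom b)).
  generalize (f_equal (comp (idm b ⊗' dd_mult Y W)) (exch 𝟙 𝟙 Hp He)).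
  flat. intros H H'. rewrite H', H. reflexivity.
- exact Hb.
Qed.

Lemma quasi_pivotal_of_invertible (A : anti_ob C) : C_invertible A ->
  quasi_pivotal C.
Proof.
intros HA.
(* The reverse transposition: [coevl A] supplies the strand [A^∨]. *)
refine (@QuasiPivotal C A HA (fun Y => (abr_inv A Y ⊗' idm A^∨) ∘ (idm Y ⊗' coevl A)) _).
split; [split|split]; simpl.
- intros Y. apply is_iso_comp with (Y := Y ⊗ A ⊗ A^∨).
  + exact (is_iso_tens (inv_iso _) (is_iso_id _)).
  + refine (is_iso_cast (is_iso_tens (is_iso_id Y) (proj2 HA)) _ _); objeq.
- intros Y Y' f Hf. pose proof (ddm_hom Hf) as Hdf.
  transitivity ((((idm A ⊗' ddm Y Y' f) ∘ abr_inv A Y) ⊗' idm A^∨) ∘ (idm Y ⊗' coevl A)).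
  { now flat. }
  rewrite (abr_inv_nat A Hf).
  generalize (f_equal (comp (abr_inv A Y' ⊗' idm A^∨)) (exch 𝟙 𝟙 Hf (coevl_hom A))).
  flat. intros H. now rewrite H.
- intros X Y. erewrite comp_idr by homt. rewrite abr_inv_tens.
  assert (Hp : [(abr_inv A X ⊗' idm A^∨) ∘ (idm X ⊗' coevl A) : X ~> A ⊗ X^∨∨ ⊗ A^∨]) by homt.
  assert (Hq : [(abr_inv A Y ⊗' idm A^∨) ∘ (idm Y ⊗' coevl A) : Y ~> A ⊗ Y^∨∨ ⊗ A^∨]) by homt.
  rewrite <- (tens_exch Hp Hq).
  (* A snake on [A] is inserted between the two half-braidings: its coevaluation belongs to the
     factor at [X], its evaluation to the multiplication of the target. *)
  transitivity ((idm A ⊗' dd_mult X Y ⊗' idm A^∨)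
    ∘ (abr_inv A X ⊗' idm Y^∨∨ ⊗' idm A^∨)
    ∘ (idm X ⊗' (((idm A ⊗' evl A) ∘ (coevl A ⊗' idm A)) ⊗' idm Y^∨∨ ⊗' idm A^∨))
    ∘ (idm X ⊗' ((abr_inv A Y ⊗' idm A^∨) ∘ (idm Y ⊗' coevl A)))).
  + rewrite snakel1, !tensm_id. erewrite comp_idr by homt. now flat.
  + generalize (f_equal (comp (idm A ⊗' dd_mult X Y ⊗' idm A^∨))
      (exch 𝟙 (Y^∨∨ ⊗ A^∨) (abr_inv_hom A X) (evl_hom A))).
    flat. intros H. rewrite H. reflexivity.
(* The unit condition holds because [abr_unit] identifies the inverse half-braiding at [𝟙] with the
   double-dual unit. *)
- assert (E : idm A ⊗' dd_unit C = abr_inv A 𝟙).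
  { pose proof (abr_hom A 𝟙) as Ha. rewrite tens1l in Ha.
    pose proof (abr_inv_hom A 𝟙) as Ha'. rewrite tens1l in Ha'.
    apply (iso_mono (abr_iso A 𝟙) (W := A)); [homt|homt|].
    rewrite abr_unit. unfold abr_inv. now rewrite inv_compr, tens1l. }
  rewrite E. erewrite tensm1l by homt.
  pose proof (abr_inv_hom A 𝟙) as Ha'.
  erewrite comp_idr by homt. reflexivity.
Qed.
End QuasiPivotal.

Theorem theorem1p2 (C : rigid) :
  (inhabited (quasi_pivotal C) <-> exists A : Ob (anti_drinfeld_centre C), C_invertible A) /\
  ((exists A : Ob (anti_drinfeld_centre C), C_invertible A) <->
   module_equivalent (regular_module (drinfeld_centre C)) (anti_drinfeld_centre C)).
Proof.
split; split.
- intros [Q]. exact (invertible_of_quasi_pivotal Q).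
- intros [A HA]. constructor. exact (quasi_pivotal_of_invertible HA).
- intros [A HA]. exact (module_equivalent_of_invertible HA).
- apply invertible_of_module_equivalent.
Qed.
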